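(* Let $\mathbb E$ be a family of diagrammatic equations in ZX, ZH or ZW, parameterised by finitely many phase variables and !-boxes, where the !-boxes are (pairwise) separated and well nested. Then one can construct a finite set of simple equations $\{\mathbb E_\kappa\}_{\kappa\in K}$ that verifies $\mathbb E$.
   Context: Diagrams are in Universal ZX, or in ZW or ZH over a field $F$ ($\tfrac12\in F$ for ZH), and diagrams $n\to m$ are interpreted as linear maps $\mathbb H^{\otimes n}\to\mathbb H^{\otimes m}$, $\mathbb H=F^2$ ($F=\mathbb C$ for ZX), with wires, swaps, cups $(1\,0\,0\,1)^T$, caps $(1\,0\,0\,1)$ as usual. Generators: ZX — Z spiders $|0\cdots0\rangle\langle0\cdots0|+e^{i\alpha}|1\cdots1\rangle\langle1\cdots1|$, X spiders (same in the basis $|\pm\rangle=\frac1{\sqrt2}(|0\rangle\pm|1\rangle)$), Hadamard gate. ZW — white spiders $|0\cdots0\rangle\langle0\cdots0|+r|1\cdots1\rangle\langle1\cdots1|$, black spiders $0\to n$ $\sum_{k}|0^{k-1}1\,0^{n-k}\rangle$ (any legs may be bent to inputs), crossing $\begin{pmatrix}1&0&0&0\\0&0&1&0\\0&1&0&0\\0&0&0&-1\end{pmatrix}$. ZH — white spiders $|0\cdots0\rangle\langle0\cdots0|+|1\cdots1\rangle\langle1\cdots1|$, H-boxes $\sum r^{i_1\cdots i_mj_1\cdots j_n}|j_1\cdots j_n\rangle\langle i_1\cdots i_m|$ (sum over bits). Phase variables are formal variables in the phases: in ZX phases are integer-linear combinations of the variables (taking values in $[0,2\pi)$) plus constants; in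 ZW and ZH phases are (Laurent) polynomials in the variables (taking values in $F$, non-zero where negative powers occur). A !-box marks a set of nodes (possibly including boundary inputs/outputs) of a diagram; instantiating it at $d\in\mathbb N$ replaces the marked part by $d$ copies, each connected to the rest of the diagram as the original was. Phase variable names are copied unchanged. A !-box in an equation is instantiated at the same number on both sides, and phase variables are instantiated simultaneously on both sides. Two !-boxes are separated if either one is nested in (contained in) the other, or no edge joins a node in one to a node in the other. The nesting order on the !-boxes of a diagram is $\delta<\delta'$ if $\delta$ is inside $\delta'$; an equation is well nested if its left- and right-hand sides have the same !-boxes with the same nesting order. An equation is simple if it contains no phase variables and no !-boxes. An equation with parameters is sound if for all values of the parameters both sides have equal interpretations; a set of equations verifies $\mathbb E$ if soundness of all of them implies soundness of $\mathbb E$. *)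

(* Defs.v *)
From Stdlib Require List.
From mathcomp Require Import all_boot all_order all_algebra.
From mathcomp Require Import reals trigo.
From mathcomp.real_closed Require Import complex.

Set Implicit Arguments.
Unset Strict Implicit.
Unset Printing Implicit Defensive.

Import Order.TTheory GRing.Theory Num.Theory.
Local Open Scope ring_scope.

(* R plays the role of the real numbers, so R[i] that of the complex ones. *)
Inductive calculus :=
  | ZX of realType
  | ZW of fieldType
  | ZH (F : fieldType) of (2%:R != 0 :> F).

Definition scalar (L : calculus) : fieldType :=
  match L with
  | ZX R => R[i]
  | ZW F => F
  | ZH F _ => F
  end.

(* What a phase variable ranges over, and what a phase without variables is:
   an angle in ZX, a scalar in ZW and ZH. *)
Definition value (L : calculus) : fieldType :=
  match L with
  | ZX R => R
  | ZW F => F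
  | ZH F _ => F
  end.

Definition in_range (L : calculus) : pred (value L) :=
  match L return pred (value L) with
  | ZX R => fun a => (0 <= a) && (a < 2 * pi)
  | ZW F => fun=> true
  | ZH F _ => fun=> true
  end.

(* (k, c) stands for c + \sum_j k_j x_j. *)
Definition zx_phase (R : realType) (p : nat) : Type :=
  ({ffun 'I_p -> int} * R)%type.

(* The list of the terms c * \prod_j x_j ^ e_j, each as the pair (c, e). *)
Definition laurent (F : fieldType) (p : nat) : Type :=
  seq (F * {ffun 'I_p -> int}).

Definition phase (L : calculus) (p : nat) : Type :=
  match L with
  | ZX R => zx_phase R p
  | ZW F => laurent F p
  | ZH F _ => laurent F p
  end.

Definition zx_eval (R : realType) p (x : {ffun 'I_p -> R})
    (f : zx_phase R p) : R :=
  f.2 + \sum_(j < p) x j *~ f.1 j.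

Definition laurent_eval (F : fieldType) p (x : {ffun 'I_p -> F})
    (f : laurent F p) : F :=
  \sum_(t <- f) t.1 * \prod_(j < p) x j ^ t.2 j.

Definition phase_eval (L : calculus) p :
    {ffun 'I_p -> value L} -> phase L p -> value L :=
  match L return {ffun 'I_p -> value L} -> phase L p -> value L with
  | ZX R => @zx_eval R p
  | ZW F => @laurent_eval F p
  | ZH F _ => @laurent_eval F p
  end.

Definition laurent_neg (F : fieldType) p (f : laurent F p) (j : 'I_p) : bool :=
  has (fun t : F * {ffun 'I_p -> int} => t.2 j < 0) f.

(* The variable j occurs in the phase with a negative power. *)
Definition phase_neg (L : calculus) p : phase L p -> 'I_p -> bool :=
  match L return phase L p -> 'I_p -> bool with
  | ZX R => fun _ _ => false
  | ZW F => @laurent_neg F p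
  | ZH F _ => @laurent_neg F p
  end.

Definition laurent_size (F : fieldType) p (f : laurent F p) : nat :=
  (\sum_(t <- f) (\sum_(j < p) absz (t.2 j)).+1)%N.

Definition phase_size (L : calculus) p : phase L p -> nat :=
  match L return phase L p -> nat with
  | ZX R => fun f => (\sum_(j < p) absz (f.1 j)).+1%N
  | ZW F => @laurent_size F p
  | ZH F _ => @laurent_size F p
  end.

Inductive zx_node (P : Type) := ZSpider of P | XSpider of P | Hadamard.
Inductive zw_node (P : Type) := WhiteSpider of P | BlackSpider | Crossing.
Inductive zh_node (P : Type) := ZHSpider | HBox of P.
Arguments Hadamard {P}.
Arguments BlackSpider {P}.
Arguments Crossing {P}.
Arguments ZHSpider {P}.

Definition node (L : calculus) (P : Type) : Type :=
  match L with
  | ZX _ => zx_node P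
  | ZW _ => zw_node P
  | ZH _ _ => zh_node P
  end.

Definition zx_map P Q (f : P -> Q) (u : zx_node P) : zx_node Q :=
  match u with
  | ZSpider a => ZSpider (f a)
  | XSpider a => XSpider (f a)
  | Hadamard => Hadamard
  end.

Definition zw_map P Q (f : P -> Q) (u : zw_node P) : zw_node Q :=
  match u with
  | WhiteSpider r => WhiteSpider (f r)
  | BlackSpider => BlackSpider
  | Crossing => Crossing
  end.

Definition zh_map P Q (f : P -> Q) (u : zh_node P) : zh_node Q :=
  match u with
  | ZHSpider => ZHSpider
  | HBox r => HBox (f r)
  end.

Definition node_map (L : calculus) P Q (f : P -> Q) : node L P -> node L Q :=
  match L return node L P -> node L Q with
  | ZX _ => zx_map f
  | ZW _ => zw_map f
  | ZH _ _ => zh_map f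
  end.

Definition node_phase (L : calculus) P : node L P -> option P :=
  match L return node L P -> option P with
  | ZX _ => fun u =>
      match u with ZSpider a | XSpider a => Some a | Hadamard => None end
  | ZW _ => fun u =>
      match u with WhiteSpider r => Some r | BlackSpider | Crossing => None end
  | ZH _ _ => fun u =>
      match u with HBox r => Some r | ZHSpider => None end
  end.

(* Every leg of a node carries a port in 'I_4.  Only crossings make use of it,
   all other generators being symmetric in their legs. *)
Definition node_ok (L : calculus) P : node L P -> seq 'I_4 -> bool :=
  match L return node L P -> seq 'I_4 -> bool with
  | ZX _ => fun u ports => if u is Hadamard then size ports == 2%N else true
  | ZW _ => fun u ports =>
      if u is Crossing then perm_eq ports (enum 'I_4) else true
  | ZH _ _ => fun _ _ => true
  end.

(* Cups and caps being (1 0 0 1), bending a leg of a node does not change the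
   entries, so that inputs and outputs of a node need not be told apart. *)

Definition spider (F : fieldType) (r : F) (bits : seq bool) : F :=
  (all negb bits)%:R + r * (all id bits)%:R.

Definition expi (R : realType) (a : R) : R[i] := (cos a +i* sin a)%C.
Definition isqrt2 (R : realType) : R[i] := ((Num.sqrt 2)^-1)%:C%C.

(* XSpider: <b|+> and <b|-> are 1/sqrt 2 and (-1)^b / sqrt 2.
   Hadamard has two legs, so (-1)^(all id bits) is (-1)^(b * b'). *)
Definition zx_entry (R : realType) (u : zx_node R) (bits : seq bool) : R[i] :=
  match u with
  | ZSpider a => spider (expi a) bits
  | XSpider a => \prod_(b <- bits) isqrt2 R
                 + expi a * \prod_(b <- bits) (isqrt2 R * (-1) ^+ b)
  | Hadamard => isqrt2 R * (-1) ^+ (all id bits)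
  end.

(* The inputs of a crossing are its ports 0 and 1, the outputs 2 and 3. *)
Definition crossing_entry (F : fieldType) (legs : seq ('I_4 * bool)) : F :=
  let bit k := has (fun l => (val l.1 == k) && l.2) legs in
  ((bit 2%N == bit 1%N) && (bit 3%N == bit 0%N))%:R *
  (-1) ^+ (bit 0%N && bit 1%N).

Definition zw_entry (F : fieldType) (u : zw_node F)
    (legs : seq ('I_4 * bool)) : F :=
  match u with
  | WhiteSpider r => spider r (unzip2 legs)
  | BlackSpider => (count id (unzip2 legs) == 1%N)%:R
  | Crossing => crossing_entry F legs
  end.

Definition zh_entry (F : fieldType) (u : zh_node F) (bits : seq bool) : F :=
  match u with
  | ZHSpider => spider 1 bits
  | HBox r => if all id bits then r else 1
  end.

Definition entry (L : calculus) :
    node L (value L) -> seq ('I_4 * bool) -> scalar L :=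
  match L return node L (value L) -> seq ('I_4 * bool) -> scalar L with
  | ZX R => fun u legs => zx_entry u (unzip2 legs)
  | ZW F => @zw_entry F
  | ZH F _ => fun u legs => zh_entry u (unzip2 legs)
  end.

(* The edge e joins ends e false to ends e true, at the ports port e false and
   port e true; each end is a generator, an input or an output.  Edges are bare
   wires (identities, cups or caps); loops counts the wires closed on
   themselves, which no !-box can mark. *)
Record diagram (L : calculus) (P : Type) (I O : finType) := Diagram {
  vert : finType;
  edge : finType;
  label : vert -> node L P;
  ends : edge -> bool -> vert + (I + O);
  port : edge -> bool -> 'I_4;
  loops : nat
}.

Section Diagram.

Variables (L : calculus) (P : Type) (I O : finType).
Implicit Type D : diagram L P I O.

Definition legs D (x : vert D + (I + O)) : seq (edge D * bool) :=
  [seq h <- enum {: edge D * bool} | ends h.1 h.2 == x].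

Definition wf_diagram D : bool :=
  [forall v, node_ok (label v) [seq port h.1 h.2 | h <- legs (D := D) (inl v)]]
  && [forall w, size (legs (D := D) (inr w)) == 1%N].

End Diagram.

Section Interpretation.

Variables (L : calculus) (I O : finType) (D : diagram L (value L) I O).

Definition compatible (x : {ffun I -> bool}) (y : {ffun O -> bool})
    (s : {ffun edge D -> bool}) : bool :=
  [forall w : I + O, all
    (fun h => s h.1 == match w with inl i => x i | inr o => y o end)
    (legs (D := D) (inr w))].

Definition amplitude (x : {ffun I -> bool}) (y : {ffun O -> bool}) : scalar L :=
  2 ^+ loops D *
  \sum_(s : {ffun edge D -> bool} | compatible x y s)
    \prod_(v : vert D)
      entry (label v) [seq (port h.1 h.2, s h.1) | h <- legs (D := D) (inl v)].

(* The basis of the tensor power H^I is indexed by {ffun I -> bool}; columns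
   are indexed by the basis of the source. *)
Definition interp :
    'M[scalar L]_(#|{: {ffun O -> bool}}|, #|{: {ffun I -> bool}}|) :=
  \matrix_(r, c) amplitude (enum_val c) (enum_val r).

End Interpretation.

Record simple_equation (L : calculus) := SimpleEquation {
  sinputs : finType;
  soutputs : finType;
  slhs : diagram L (value L) sinputs soutputs;
  srhs : diagram L (value L) sinputs soutputs;
  swf : wf_diagram slhs && wf_diagram srhs
}.

Definition sound_simple (L : calculus) (e : simple_equation L) : Prop :=
  interp (slhs e) = interp (srhs e).

Section Copies.

Variables (b : nat) (d : {ffun 'I_b -> nat}).

Definition copy_index : finType := {ffun 'I_b -> 'I_(\max_j d j).+1%N}.

(* c numbers the copies of something lying in the !-boxes A: it is only
   relevant on A, and is set to 0 elsewhere. *)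
Definition index_ok (A : {set 'I_b}) (c : copy_index) : bool :=
  [forall j, (c j < if j \in A then d j else 1)%N].

Definition copies (T : finType) (S : T -> {set 'I_b}) : finType :=
  {tc : T * copy_index | index_ok (S tc.1) tc.2}.

Definition cut (A : {set 'I_b}) (c : copy_index) : copy_index :=
  [ffun j => if j \in A then c j else ord0].

Lemma cut_ok (A A' : {set 'I_b}) (c : copy_index) :
  A \subset A' -> index_ok A' c -> index_ok A (cut A c).
Proof.
move=> /subsetP sAA' /forallP cP; apply/forallP => j; rewrite ffunE.
by case: ifP => // jA; have := cP j; rewrite sAA'.
Qed.

Definition copy (T : finType) (S : T -> {set 'I_b}) (t : T) (A : {set 'I_b})
    (c : copy_index) (sSA : S t \subset A) (cP : index_ok A c) : copies S :=
  exist _ (t, cut (S t) c) (cut_ok sSA cP).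

End Copies.

Definition node_boxes (b : nat) (V : finType) (W : finType)
    (vbox : 'I_b -> {set V}) (wbox : 'I_b -> {set W}) (x : V + W) :
    {set 'I_b} :=
  match x with
  | inl v => [set j | v \in vbox j]
  | inr w => [set j | w \in wbox j]
  end.

(* The !-box j marks the
   generators in vbox j and the inputs and outputs in wbox j.  The relation
   inside is the nesting order. It is part of the data because the marked sets
   do not determine it when one !-box contains nothing but another one. *)
Record family (L : calculus) (p b : nat) (I O : finType)
    (wbox : 'I_b -> {set I + O}) := Family {
  graph :> diagram L (phase L p) I O;
  vbox : 'I_b -> {set vert graph};
  inside : rel 'I_b;
  inside_irr : irreflexive inside;
  inside_trans : transitive inside;
  inside_sub : forall j k, inside j k ->
    (vbox j \subset vbox k) && (wbox j \subset wbox k)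
}.
Arguments vbox {L p b I O wbox} f j.

Section Instance.

Variables (L : calculus) (p b : nat) (I O : finType).
Variables (wbox : 'I_b -> {set I + O}) (D : family L p wbox).

Definition boxes (x : vert D + (I + O)) : {set 'I_b} :=
  node_boxes (vbox D) wbox x.

Definition edge_boxes (e : edge D) : {set 'I_b} :=
  boxes (ends e false) :|: boxes (ends e true).

Lemma ends_boxes (e : edge D) (t : bool) : boxes (ends e t) \subset edge_boxes e.
Proof. by case: t; rewrite ?subsetUl ?subsetUr. Qed.

Definition in_boxes (i : I) : {set 'I_b} := [set j | inl i \in wbox j].
Definition out_boxes (o : O) : {set 'I_b} := [set j | inr o \in wbox j].
Definition vert_boxes (v : vert D) : {set 'I_b} :=
  [set j | v \in vbox D j].

Variables (d : {ffun 'I_b -> nat}) (x : {ffun 'I_p -> value L}).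

(* An edge is copied once for every way of choosing a copy of each !-box
   containing one of its ends, and joins the copies of its ends so chosen. *)
Definition copy_end (y : vert D + (I + O)) (A : {set 'I_b}) (c : copy_index d)
    (cP : index_ok A c) :
    boxes y \subset A ->
    copies d vert_boxes + (copies d in_boxes + copies d out_boxes) :=
  match y return boxes y \subset A -> _ with
  | inl v => fun s => inl (copy (S := vert_boxes) s cP)
  | inr (inl i) => fun s => inr (inl (copy (S := in_boxes) s cP))
  | inr (inr o) => fun s => inr (inr (copy (S := out_boxes) s cP))
  end.

(* The !-box j is instantiated at d j and the phase variable j at x j.  All
   copies of a nested !-box keep its name, hence are instantiated at the same
   number. *)
Definition instance :
    diagram L (value L) (copies d in_boxes) (copies d out_boxes) :=
  @Diagram L (value L) (copies d in_boxes) (copies d out_boxes)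
    (copies d vert_boxes)
    (copies d edge_boxes)
    (fun v => node_map (phase_eval x) (label (val v).1))
    (fun e t => copy_end (valP e) (ends_boxes (val e).1 t))
    (fun e t => port (val e).1 t)
    (loops D).

Definition var_neg (j : 'I_p) : bool :=
  [exists v : vert D,
    if node_phase (label v) is Some f then phase_neg f j else false].

Definition family_size : nat :=
  (#|vert D| + #|edge D| + loops D +
   \sum_(v : vert D) oapp (@phase_size L p) 0 (node_phase (label v)))%N.

Definition separated_family : Prop := forall j k : 'I_b, j != k ->
  [|| inside D j k, inside D k j |
      ~~ [exists e : edge D, exists t : bool,
            (j \in boxes (ends e t)) && (k \in boxes (ends e (~~ t)))]].

End Instance.

(* The two sides share their phase variables, !-boxes and boundary.  The last
   field says that instances make sense: a Hadamard gate or a crossing always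
   gets the right number of legs, an input or an output exactly one wire. *)
Record equation (L : calculus) := Equation {
  nvar : nat;
  nbox : nat;
  nin : nat;
  nout : nat;
  wbox : 'I_nbox -> {set 'I_nin + 'I_nout};
  lhs : family L nvar wbox;
  rhs : family L nvar wbox;
  equation_wf : forall d x,
    wf_diagram (instance lhs d x) && wf_diagram (instance rhs d x)
}.

Section Equation.

Variables (L : calculus) (E : equation L).

Definition at_params (d : {ffun 'I_(nbox E) -> nat})
    (x : {ffun 'I_(nvar E) -> value L}) : simple_equation L :=
  SimpleEquation (equation_wf (e := E) d x).

Definition admissible (x : {ffun 'I_(nvar E) -> value L}) : bool :=
  [forall j, in_range (x j) &&
    ((var_neg (lhs E) j || var_neg (rhs E) j) ==> (x j != 0))].

Definition sound : Prop := forall d x, admissible x ->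
  sound_simple (at_params d x).

Definition separated : Prop :=
  separated_family (lhs E) /\ separated_family (rhs E).

Definition well_nested : Prop := inside (lhs E) =2 inside (rhs E).

Definition verifies (K : seq (simple_equation L)) : Prop :=
  (forall e, List.In e K -> sound_simple e) -> sound.

(* The instances of E with at most n copies of each !-box and phase variables
   taking their values in s. *)
Definition instances (n : nat) (s : seq (value L)) : seq (simple_equation L) :=
  let ds := [seq [ffun j => val (k j)] | k : {ffun 'I_(nbox E) -> 'I_n.+1}] in
  let xs := [seq [ffun j => tnth (in_tuple s) (k j)]
              | k : {ffun 'I_(nvar E) -> 'I_(size s)}] in
  [seq at_params d x | d <- ds, x <- filter admissible xs].

(* A measure of the combinatorial content of E. The scalars and angles in its
   phases play no part in it. *)
Definition equation_size : nat :=
  (nvar E + nbox E + nin E + nout E + family_size (lhs E) + family_size (rhs E))%N.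

End Equation.

(* The total recursive functions. *)
Inductive recursive : forall k : nat, (k.-tuple nat -> nat) -> Prop :=
  | Rec_zero k : recursive (fun _ : k.-tuple nat => 0%N)
  | Rec_succ : recursive (fun v : 1.-tuple nat => (thead v).+1)
  | Rec_proj k (i : 'I_k) : recursive (fun v : k.-tuple nat => tnth v i)
  | Rec_comp k m (f : m.-tuple nat -> nat) (g : 'I_m -> k.-tuple nat -> nat) :
      recursive f -> (forall i, recursive (g i)) ->
      recursive (fun v : k.-tuple nat => f [tuple g i v | i < m])
  | Rec_prim k (f : k.-tuple nat -> nat) (g : k.+2.-tuple nat -> nat) :
      recursive f -> recursive g ->
      recursive (fun v : k.+1.-tuple nat =>
        iteri (thead v) (fun n r => g [tuple of n :: r :: behead_tuple v])
              (f (behead_tuple v)))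
  | Rec_min k (f : k.+1.-tuple nat -> nat)
      (ex : forall v : k.-tuple nat, exists n, f [tuple of n :: v] == 0%N) :
      recursive f -> recursive (fun v : k.-tuple nat => ex_minn (ex v))
  | Rec_ext k (f g : k.-tuple nat -> nat) :
      f =1 g -> recursive f -> recursive g.

Definition computable (N : nat -> nat) : Prop :=
  recursive (fun v : 1.-tuple nat => N (thead v)).

(* n distinct values for a phase variable, or all of them. *)
Definition sample (L : calculus) (n : nat) (s : seq (value L)) : Prop :=
  [/\ uniq s, all (@in_range L) s &
      size s = n \/ (forall a : value L, in_range a -> a \in s)].

(* Classically, every equation E is verified by some finite set of simple
   equations for a trivial reason: the empty set if E is sound, an unsound
   instance otherwise.  What is meant by constructing such a set is that it can
   be found without knowing whether E is sound.  Here it consists of the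
   instances of E up to a bound computed from the size of E, at values of the
   phase variables which depend on that bound only. *)
Definition construction (L : calculus)
    (K : equation L -> seq (simple_equation L)) : Prop :=
  exists (N : nat -> nat) (s : nat -> seq (value L)),
    [/\ computable N,
        forall n, sample n (s n) &
        forall E, K E = instances E (N (equation_size E))
                                    (s (N (equation_size E)))].

(* Main.v *)
(** The tensor of a generator factors, up to one scalar per leg, through a
    statistic of its legs valued in a fixed finite commutative monoid.  Hence a
    diagram with [n] copies of a !-box is a weighted sum over words of length
    [n]: a copy acts on the rest of the diagram only through the statistics of
    the vertices outside the box to which it is attached, so both sides are
    values of linear automata whose number of states does not depend on [n].
    Two automata with [q1] and [q2] states agree on all words as soon as they
    agree on words of length at most [q1 + q2].  Separation forces the vertices
    attached to a box from outside to lie only in boxes containing it, so the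
    state space for a box is bounded in terms of the copies of the boxes around
    it, and the bounds can be computed from the outermost boxes inwards.  For
    bounded numbers of copies, both sides are Laurent polynomials of bounded
    degree in each phase variable (in [e^(i x)] for ZX), hence determined by
    finitely many values. *)

From HB Require Import structures.
From mathcomp Require Import all_boot all_order all_algebra.
From mathcomp Require Import reals trigo.
From mathcomp Require Import zify lra.
From mathcomp.real_closed Require Import complex.
From mathcomp Require boolp.
Require Import Defs.

Set Implicit Arguments.
Unset Strict Implicit.
Unset Printing Implicit Defensive.

Import Order.TTheory GRing.Theory Num.Theory.

Local Open Scope ring_scope.

(** * Linear automata *)

Section Words.
Variables (F : fieldType) (B : finType).

Fixpoint wordmx q (T : B -> 'M[F]_q) (w : seq B) : 'M[F]_q :=
  if w is b :: w' then T b *m wordmx T w' else 1%:M.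

Lemma wordmx_rcons q (T : B -> 'M[F]_q) w b :
  wordmx T (rcons w b) = wordmx T w *m T b.
Proof.
by elim: w => [|a w IH] /=; rewrite ?mul1mx ?mulmx1 // IH mulmxA.
Qed.

Section Rank.
Variables (q : nat) (u : 'rV[F]_q) (T : B -> 'M[F]_q).

(** The span of the vectors [u *m wordmx T w] over the words [w] of length at most [n], as a row
    space. *)
Fixpoint reach (n : nat) : 'M[F]_q :=
  if n is m.+1 then (reach m + \sum_b reach m *m T b)%MS else <<u>>%MS.

Lemma reach_leq m n : (m <= n)%N -> (reach m <= reach n)%MS.
Proof.
move=> /subnK<-; elim: (n - m)%N => [|i IH] //.
exact: submx_trans IH (addsmxSl _ _).
Qed.

Lemma reach_step n b : (reach n *m T b <= reach n.+1)%MS.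
Proof.
apply: submx_trans (addsmxSr _ _).
exact: (sumsmx_sup b).
Qed.

Lemma reach_stable n m : (reach n.+1 <= reach n)%MS -> (reach m <= reach n)%MS.
Proof.
move=> st; elim: m => [|m IH]; first exact: (@reach_leq 0).
rewrite /= addsmx_sub IH; apply/sumsmx_subP => b _.
exact: submx_trans (submxMr _ IH) (submx_trans (reach_step n b) st).
Qed.

(** As long as the chain grows, each stage raises the rank, which is at most [q]. So it stalls at
    some stage up to [q], and a stage where it stalls is stable under every letter. *)
Lemma reach_sub m : (reach m <= reach q)%MS.
Proof.
have [/existsP[n st]|/existsPn grow] :=
    boolP [exists n : 'I_q.+1, (reach n.+1 <= reach n)%MS].
  by apply: submx_trans (reach_stable m st) (reach_leq _); rewrite -ltnS.
have rk n : (n <= q.+1)%N -> (n <= \rank (reach n))%N.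
  elim: n => [|n IH] // nq; apply: (leq_ltn_trans (IH (ltnW nq))).
  have := grow (Ordinal nq).
  rewrite -(geq_leqif (mxrank_leqif_sup (reach_leq (leqnSn n)))).
  by rewrite -ltnNge.
by have := leq_trans (rk _ (leqnn _)) (rank_leq_col _); rewrite ltnn.
Qed.

Lemma word_reach w : (u *m wordmx T w <= reach (size w))%MS.
Proof.
elim/last_ind: w => [|w b IH]; first by rewrite mulmx1 genmxE.
rewrite wordmx_rcons mulmxA size_rcons.
exact: submx_trans (submxMr _ IH) (reach_step _ _).
Qed.

Lemma reach_vanish (g : 'cV[F]_q) n :
  (forall w, (size w <= n)%N -> u *m wordmx T w *m g = 0) ->
  reach n *m g = 0.
Proof.
(* A letter used in forming [reach m.+1] is moved to the front of the suffix [w], so that the sum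
   [m + v] stays bounded by [n]. *)
move=> H; suff K m v : (m + v <= n)%N -> forall w, size w = v ->
    reach m *m (wordmx T w *m g) = 0.
  by have := K n 0%N; rewrite addn0 => /(_ (leqnn _) [::] erefl); rewrite mul1mx.
elim: m v => [|m IH] v mv w sw.
  apply/eqP; rewrite -submx0 /= (eqmxMr _ (genmxE u)) mulmxA H ?sub0mx //.
  by rewrite sw.
apply/eqP; rewrite -submx0 /= addsmxMr addsmx_sub.
rewrite (IH v) ?sub0mx ?(leq_trans _ mv) ?leq_add2r //= sumsmxMr_gen.
apply/sumsmx_subP => b _.
have := IH v.+1 _ (b :: w); rewrite addnS /= => IHb.
by rewrite genmxE; move: IHb; rewrite !mulmxA sw => ->; rewrite ?sub0mx.
Qed.

Lemma words_vanish (g : 'cV[F]_q) :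
  (forall w, (size w <= q)%N -> u *m wordmx T w *m g = 0) ->
  forall w, u *m wordmx T w *m g = 0.
Proof.
move=> /reach_vanish r0 w; apply/eqP; rewrite -submx0.
have := submxMr g (submx_trans (word_reach w) (reach_sub _)).
by rewrite r0 => /submx_trans; apply; apply: sub0mx.
Qed.
End Rank.

(** The difference of the two values is computed by a single automaton on the direct sum of the
    state spaces, of dimension [q1 + q2]. *)
Lemma words_agree q1 q2 (u1 : 'rV[F]_q1) (u2 : 'rV[F]_q2)
    (T1 : B -> 'M[F]_q1) (T2 : B -> 'M[F]_q2) (g1 : 'cV[F]_q1) (g2 : 'cV[F]_q2) :
  (forall w, (size w <= q1 + q2)%N ->
     u1 *m wordmx T1 w *m g1 = u2 *m wordmx T2 w *m g2) ->
  forall w, u1 *m wordmx T1 w *m g1 = u2 *m wordmx T2 w *m g2.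
Proof.
pose T b := block_mx (T1 b) 0 0 (T2 b).
have wT w : wordmx T w = block_mx (wordmx T1 w) 0 0 (wordmx T2 w).
  elim: w => [|b w IH] /=; first by rewrite -scalar_mx_block.
  by rewrite IH mulmx_block !mulmx0 !mul0mx !addr0 !add0r.
have val w : row_mx u1 u2 *m wordmx T w *m col_mx g1 (- g2) =
    u1 *m wordmx T1 w *m g1 - u2 *m wordmx T2 w *m g2.
  by rewrite wT mul_row_block !mulmx0 addr0 add0r mul_row_col mulmxN.
move=> H w; apply/eqP; rewrite -subr_eq0 -val; apply/eqP.
by apply: words_vanish => {}w sw; rewrite val H // subrr.
Qed.

(** * Weighted sums over words with a monoid-valued statistic *)

Section WordSum.
Variables (Q : finNmodType) (S : finType).
Variables (mu : S -> Q) (P : B -> S -> F) (G : Q -> F).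

(** Here [beta c] stands for the boundary data of the copy [c] of a !-box and [s c] for its internal
    configuration. The copies act on the rest, represented by [G], through the total of the
    [mu (s c)]. *)
Definition wordsum n (beta : 'I_n -> B) (q0 : Q) : F :=
  \sum_(s : {ffun 'I_n -> S})
    G (q0 + \sum_c mu (s c)) * \prod_c P (beta c) (s c).

Definition stepmx b : 'M[F]_#|Q| :=
  \matrix_(i, j) \sum_(s | enum_val i + mu s == enum_val j) P b s.

Definition valcol : 'cV[F]_#|Q| := \col_i G (enum_val i).

Lemma wordsum0 (beta : 'I_0 -> B) q0 : wordsum beta q0 = G q0.
Proof.
rewrite /wordsum (big_pred1 [ffun c : 'I_0 => False_rect S (notF (ltn_ord c))]).
  by rewrite !big_ord0 addr0 mulr1.
by move=> s; apply/esym/eqP/ffunP => -[].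
Qed.

Lemma wordsumS n (beta : 'I_n.+1 -> B) q0 :
  wordsum beta q0 =
  \sum_s P (beta ord0) s * wordsum (beta \o lift ord0) (q0 + mu s).
Proof.
rewrite /wordsum.
under [RHS]eq_bigr do rewrite mulr_sumr.
rewrite pair_big /=.
pose h (t : S * {ffun 'I_n -> S}) : {ffun 'I_n.+1 -> S} :=
  [ffun c => oapp t.2 t.1 (unlift ord0 c)].
pose h' (s : {ffun 'I_n.+1 -> S}) := (s ord0, [ffun c => s (lift ord0 c)]).
rewrite (reindex h) /=; last first.
  exists h' => [[a t]|s] _; rewrite /h /h' /= ?ffunE ?unlift_none.
    by congr pair; apply/ffunP => c; rewrite !ffunE liftK.
  by apply/ffunP => c; rewrite !ffunE; case: unliftP => [j ->|->]; rewrite /= ?ffunE.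
apply: eq_bigr => -[a t] _ /=.
rewrite !big_ord_recl !ffunE unlift_none /= addrA mulrCA.
congr (_ * (G (_ + _) * _)); apply: eq_bigr => c _;
  by rewrite !ffunE liftK.
Qed.

(** The states are the elements of [Q]: on reading [b], the automaton passes from [q] to [q + mu s]
    with weight [P b s]; its final vector holds the values of [G]. *)
Lemma wordsumE n (beta : 'I_n -> B) q0 :
  (delta_mx 0 (enum_rank q0) : 'rV_ _) *m wordmx stepmx (codom beta) *m valcol
  = (wordsum beta q0)%:M.
Proof.
elim: n beta q0 => [|n IH] beta q0.
  rewrite wordsum0 /codom /image_mem; have -> : enum 'I_0 = [::].
    by apply: size0nil; rewrite size_enum_ord.
  rewrite /= mulmx1 -rowE; apply/rowP => i.
  by rewrite !mxE enum_rankK ord1 eqxx.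
rewrite wordsumS raddf_sum /= codomE enum_ordSl /= -map_comp.
rewrite mulmxA -rowE.
have -> : row (enum_rank q0) (stepmx (beta ord0)) =
    \sum_s P (beta ord0) s *: delta_mx 0 (enum_rank (q0 + mu s)).
  apply/rowP => j; rewrite !mxE summxE enum_rankK big_mkcond /=.
  apply: eq_bigr => s _; rewrite !mxE eqxx /=.
  rewrite -(can_eq enum_rankK) enum_valK eq_sym.
  by case: eqP; rewrite ?mulr1 ?mulr0.
rewrite !mulmx_suml; apply: eq_bigr => s _.
rewrite -!scalemxAl -scale_scalar_mx -IH; congr (_ *: (_ *m wordmx _ _ *m _)).
Qed.
End WordSum.

Lemma wordsum_agree (Q1 Q2 : finNmodType) (S1 S2 : finType)
    (mu1 : S1 -> Q1) (mu2 : S2 -> Q2) (P1 : B -> S1 -> F) (P2 : B -> S2 -> F)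
    (G1 : Q1 -> F) (G2 : Q2 -> F) :
  (forall n (beta : 'I_n -> B), (n <= #|Q1| + #|Q2|)%N ->
     wordsum mu1 P1 G1 beta 0 = wordsum mu2 P2 G2 beta 0) ->
  forall n (beta : 'I_n -> B),
     wordsum mu1 P1 G1 beta 0 = wordsum mu2 P2 G2 beta 0.
Proof.
move=> H n beta.
have := @words_agree _ _ (delta_mx 0 (enum_rank (0 : Q1)))
  (delta_mx 0 (enum_rank (0 : Q2))) (stepmx mu1 P1) (stepmx mu2 P2)
  (valcol G1) (valcol G2) _ (codom beta).
rewrite !wordsumE => /(_ _)/(congr1 (fun A : 'M_1 => A 0 0)).
rewrite !mxE eqxx !mulr1n; apply => w sw.
(* A word is presented as a function on its positions, the form in which [wordsumE] takes it. *)
have -> : w = codom (tnth (in_tuple w)) by rewrite codomE map_tnth_enum.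
by rewrite !wordsumE H.
Qed.
End Words.

(** * Leg statistics of the generators *)

(* The natural numbers with n and n + 2 identified for n >= 2.  This quotient
   retains the parity needed by X spiders, and whether a number is 0 or 1. *)
Definition tally := 'I_4.
HB.instance Definition _ := Finite.on tally.

Definition tally_of (n : nat) : tally :=
  inord (if n < 4 then n else 2 + odd n)%N.

Lemma val_tally n : tally_of n = (if (n < 4)%N then n else 2 + odd n)%N :> nat.
Proof. by rewrite inordK //; case: (ltnP n 4) => // _; case: (odd n). Qed.

Definition add_tally (x y : tally) : tally := tally_of (x + y)%N.

Lemma add_tallyA : associative add_tally.
Proof.
by move=> [[|[|[|[|?]]]] ?] [[|[|[|[|?]]]] ?] [[|[|[|[|?]]]] ?] //;
  apply: ord_inj; rewrite /add_tally !val_tally.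
Qed.

Lemma add_tallyC : commutative add_tally.
Proof. by move=> x y; rewrite /add_tally addnC. Qed.

Lemma add_tally0 : left_id (tally_of 0) add_tally.
Proof.
by move=> [[|[|[|[|?]]]] ?] //; apply: ord_inj; rewrite /add_tally !val_tally.
Qed.

HB.instance Definition _ :=
  GRing.isNmodule.Build tally add_tallyA add_tallyC add_tally0.

Lemma tally_ofD m n : tally_of (m + n)%N = tally_of m + tally_of n.
Proof.
apply: ord_inj; rewrite [RHS]val_tally !val_tally.
have [m4|m4] := ltnP m 4; have [n4|n4] := ltnP n 4 => //.
- rewrite ltnNge (leq_trans n4) ?leq_addl //=.
  by case: m m4 => [|[|[|[|?]]]] //= _; case: (odd n).
- rewrite ltnNge (leq_trans m4) ?leq_addr //= oddD.
  by case: n n4 => [|[|[|[|?]]]] //= _; case: (odd m).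
- rewrite ltnNge (leq_trans m4) ?leq_addr //= oddD.
  by case: (odd m); case: (odd n).
Qed.

Lemma tally_eq0 n : ((tally_of n : nat) == 0%N) = (n == 0%N).
Proof. by rewrite val_tally; case: ltnP => //; case: n. Qed.

Lemma tally_eq1 n : ((tally_of n : nat) == 1%N) = (n == 1%N).
Proof. by rewrite val_tally; case: ltnP => //; case: n => [|[]]. Qed.

Lemma odd_tally n : odd (tally_of n : nat) = odd n.
Proof. by rewrite val_tally; case: ltnP => // _; rewrite oddD /= oddb. Qed.

HB.instance Definition _ (M N : finNmodType) := GRing.Nmodule.on (M * N)%type.
HB.instance Definition _ (X : finType) (M : finNmodType) :=
  GRing.Nmodule.on {ffun X -> M}.

(** Tallies of the legs carrying 1, of the legs carrying 0 and, for the sake of crossings, of the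
    legs carrying 1 at each port. *)
Definition stat : finNmodType := (tally * tally * {ffun 'I_4 -> tally})%type.

Definition stat_of (legs : seq ('I_4 * bool)) : stat :=
  (tally_of (count (fun l => l.2) legs), tally_of (count (fun l => ~~ l.2) legs),
   [ffun k => tally_of (count (fun l => (l.1 == k) && l.2) legs)]).

Lemma stat_of_cat s t : stat_of (s ++ t) = stat_of s + stat_of t.
Proof.
rewrite /stat_of !count_cat !tally_ofD; congr (_, _, _).
by apply/ffunP => k; rewrite !ffunE count_cat tally_ofD.
Qed.

Lemma stat_of_nil : stat_of [::] = 0.
Proof. by congr (_, _, _); apply/ffunP => k; rewrite !ffunE. Qed.

Lemma stat_of_sum s : stat_of s = \sum_(l <- s) stat_of [:: l].
Proof.
elim: s => [|l s IH]; first by rewrite big_nil stat_of_nil.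
by rewrite big_cons -cat1s stat_of_cat IH.
Qed.

Lemma card_stat : #|stat| = (4 ^ 6)%N.
Proof.
have c : #|(tally : finNmodType)| = 4%N by exact: (card_ord 4).
by rewrite [LHS]card_prod card_prod card_ffun !c; exact: esym (expnD 4 2 4).
Qed.

Definition ones (m : stat) : nat := m.1.1.
Definition zeros (m : stat) : nat := m.1.2.
Definition at_port (m : stat) (k : nat) : bool :=
  (m.2 (inord k) : nat) != 0%N.

Lemma count_eq0 (T : Type) (a : pred T) s : (count a s == 0%N) = all (predC a) s.
Proof. by rewrite all_predC has_count -eqn0Ngt. Qed.

Lemma ones_eq0 s : (ones (stat_of s) == 0%N) = all negb (unzip2 s).
Proof. by rewrite tally_eq0 count_eq0 all_map. Qed.

Lemma zeros_eq0 s : (zeros (stat_of s) == 0%N) = all id (unzip2 s).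
Proof.
by rewrite tally_eq0 count_eq0 all_map; apply: eq_all => l; apply: negbK.
Qed.

Lemma at_portE s k : (k < 4)%N ->
   at_port (stat_of s) k = has (fun l => (val l.1 == k) && l.2) s.
Proof.
move=> k4; rewrite /at_port ffunE tally_eq0 -lt0n -has_count.
by apply: eq_has => l /=; congr (_ && _); rewrite -val_eqE /= inordK.
Qed.

Definition spider_stat (F : fieldType) (r : F) (m : stat) : F :=
  (ones m == 0%N)%:R + r * (zeros m == 0%N)%:R.

Lemma spiderE (F : fieldType) (r : F) s :
  spider r (unzip2 s) = spider_stat r (stat_of s).
Proof. by rewrite /spider_stat ones_eq0 zeros_eq0. Qed.

(** The factor contributed once per leg. It is split off because an X spider has a factor 1/sqrt 2
    for each leg, and tallies do not determine the number of legs. *)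
Definition node_weight (L : calculus) : node L (value L) -> scalar L :=
  match L return node L (value L) -> scalar L with
  | ZX R => fun u => if u is XSpider _ then isqrt2 R else 1
  | ZW F => fun=> 1
  | ZH F _ => fun=> 1
  end.

Definition node_stat (L : calculus) : node L (value L) -> stat -> scalar L :=
  match L return node L (value L) -> stat -> scalar L with
  | ZX R => fun u m =>
      match u with
      | ZSpider a => spider_stat (expi a) m
      | XSpider a => 1 + expi a * (-1) ^+ odd (ones m)
      | Hadamard => isqrt2 R * (-1) ^+ (zeros m == 0%N)
      end
  | ZW F => fun u m =>
      match u with
      | WhiteSpider r => spider_stat r m
      | BlackSpider => (ones m == 1%N)%:R
      | Crossing =>
          ((at_port m 2 == at_port m 1) && (at_port m 3 == at_port m 0))%:R *
          (-1) ^+ (at_port m 0 && at_port m 1)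
      end
  | ZH F _ => fun u m =>
      match u with
      | ZHSpider => spider_stat 1 m
      | HBox r => if zeros m == 0%N then r else 1
      end
  end.

(** Z and white spiders, Hadamard gates and H-boxes test whether all legs carry one given bit, X
    spiders need the parity of the ones, black spiders whether there is exactly one, crossings the
    bit at each port. All of this can be read off a [stat]. *)
Lemma entry_stat (L : calculus) (u : node L (value L)) s :
  entry u s = node_weight u ^+ size s * node_stat u (stat_of s).
Proof.
case: L u => [R|F|F F2].
- case=> [a|a|] /=; rewrite ?expr1n ?mul1r ?spiderE ?zeros_eq0 //.
  rewrite mulrDr mulr1; congr (_ + _).
    by rewrite big_map big_const_seq count_predT iter_mulr_1.
  rewrite mulrCA; congr (_ * _); rewrite big_split /= !big_map.
  rewrite big_const_seq count_predT iter_mulr_1; congr (_ * _).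
  rewrite /ones odd_tally; elim: s => [|l s IH]; first by rewrite big_nil.
  by rewrite big_cons IH -signr_addb /= oddD oddb.
- case=> [r||] /=; rewrite expr1n mul1r ?spiderE //.
    by rewrite /ones tally_eq1 count_map.
  by rewrite /crossing_entry !at_portE.
- by case=> [|r] /=; rewrite expr1n mul1r ?spiderE ?zeros_eq0.
Qed.

(** * Networks and their copies *)

Section Net.
Variables (F : fieldType) (X E : finType).
Variables (ends : E -> bool -> X) (port : E -> bool -> 'I_4).
Variables (f : X -> stat -> F) (w : X -> F).

Definition half_stat (s : {ffun E -> bool}) (h : E * bool) : stat :=
  stat_of [:: (port h.1 h.2, s h.1)].

Definition site_stat (s : {ffun E -> bool}) (x : X) : stat :=
  \sum_(h : E * bool | ends h.1 h.2 == x) half_stat s h.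

(** The partition function of a tensor network whose sites are generators, inputs and outputs alike.
    The leg weights do not depend on the bits, hence stand outside the sum. *)
Definition net_sum : F :=
  (\sum_(s : {ffun E -> bool}) \prod_x f x (site_stat s x)) *
  \prod_(h : E * bool) w (ends h.1 h.2).
End Net.

Lemma net_sum_iso (F : fieldType) (X X' E E' : finType)
    (ends : E -> bool -> X) (port : E -> bool -> 'I_4)
    (f : X -> stat -> F) (w : X -> F)
    (ends' : E' -> bool -> X') (port' : E' -> bool -> 'I_4)
    (f' : X' -> stat -> F) (w' : X' -> F)
    (phi : X' -> X) (psi : E' -> E) :
  bijective phi -> bijective psi ->
  (forall e t, ends (psi e) t = phi (ends' e t)) ->
  (forall e t, port (psi e) t = port' e t) ->
  (forall x, f (phi x) =1 f' x) -> (forall x, w (phi x) = w' x) ->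
  net_sum ends port f w = net_sum ends' port' f' w'.
Proof.
move=> bphi bpsi Hends Hport Hf Hw.
have bh : bijective (fun h : E' * bool => (psi h.1, h.2)).
  case: bpsi => psi' K K'; exists (fun h => (psi' h.1, h.2)) => -[e t] /=.
    by rewrite K.
  by rewrite K'.
rewrite /net_sum; congr (_ * _); last first.
  rewrite (reindex _ (onW_bij _ bh)) /=.
  by apply: eq_bigr => h _; rewrite Hends Hw.
case: bpsi bh => psi' K K' bh.
rewrite (reindex (fun s : {ffun E' -> bool} => [ffun e => s (psi' e)])) /=.
  apply: eq_bigr => s _; rewrite (reindex _ (onW_bij _ bphi)) /=.
  apply: eq_bigr => x _; rewrite Hf; congr (f' x _).
  rewrite /site_stat (reindex _ (onW_bij _ bh)) /=.
  apply: eq_big => [[e t]|[e t] _] /=; first by rewrite Hends (bij_eq bphi).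
  by rewrite /half_stat /= ffunE K Hport.
exists (fun s : {ffun E -> bool} => [ffun e => s (psi e)]) => s _.
  by apply/ffunP => e; rewrite !ffunE K.
by apply/ffunP => e; rewrite !ffunE K'.
Qed.

(** Makes an input or output held at the bit [b] a site like any other: none of its legs may carry
    the opposite bit. *)
Definition check_bit (F : fieldType) (b : bool) (m : stat) : F :=
  (if b then zeros m == 0%N else ones m == 0%N)%:R.

Lemma prod_natr_forall (F : fieldType) (T : finType) (P : pred T) :
  \prod_(i : T) (P i)%:R = [forall i, P i]%:R :> F.
Proof.
case: forallP => [PT|/forallP]; first by rewrite big1 // => i _; rewrite PT.
by rewrite negb_forall => /existsP[i /negPf Pi]; rewrite (bigD1 i) //= Pi mul0r.
Qed.

Section Amplitude.
Variables (L : calculus) (I O : finType) (D : diagram L (value L) I O).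
Variable bit : I + O -> bool.

Definition site_fun (z : vert D + (I + O)) : stat -> scalar L :=
  match z with
  | inl v => node_stat (label v)
  | inr w => check_bit (scalar L) (bit w)
  end.

Definition site_weight (z : vert D + (I + O)) : scalar L :=
  if z is inl v then node_weight (label v) else 1.

Lemma big_legs (T : nmodType) z (G : edge D * bool -> T) :
  \sum_(h <- legs (D := D) z) G h = \sum_(h | ends h.1 h.2 == z) G h.
Proof. by rewrite /legs big_filter big_enum_cond. Qed.

Lemma size_legs z :
  size (legs (D := D) z) = #|[pred h : edge D * bool | ends h.1 h.2 == z]|.
Proof. by rewrite cardE /enum_mem /legs -enumT. Qed.

Lemma site_stat_legs (s : {ffun edge D -> bool}) z :
  site_stat (@ends L _ I O D) (@port L _ I O D) s z =
  stat_of [seq (port h.1 h.2, s h.1) | h <- legs (D := D) z].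
Proof.
by rewrite stat_of_sum big_map big_legs.
Qed.

(** The condition [compatible] becomes the product of the [check_bit] factors, and the powers of
    [node_weight] become a product over half-edges. *)
Lemma amplitude_net :
  amplitude D [ffun i => bit (inl i)] [ffun o => bit (inr o)] =
  2 ^+ loops D *
  net_sum (@ends L _ I O D) (@port L _ I O D) site_fun site_weight.
Proof.
rewrite /amplitude /net_sum; congr (_ * _).
have -> : \prod_(h : edge D * bool) site_weight (ends h.1 h.2) =
    \prod_v node_weight (label v) ^+ size (legs (D := D) (inl v)).
  rewrite (partition_big (fun h : edge D * bool => ends h.1 h.2) predT) //=.
  rewrite big_sumType /= [X in _ * X]big1 ?mulr1; last first.
    by move=> w _; rewrite big1 // => h /eqP->.
  apply: eq_bigr => v _; rewrite size_legs -prodr_const.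
  by apply: eq_bigr => h /eqP->.
rewrite mulr_suml big_mkcond /=; apply: eq_bigr => s _.
rewrite big_sumType /= mulrAC -big_split /=.
have -> : @compatible L I O D [ffun i => bit (inl i)] [ffun o => bit (inr o)] s =
    [forall w, all (fun h => s h.1 == bit w) (legs (D := D) (inr w))].
  by apply: eq_forallb => -[w|w]; apply: eq_all => h; rewrite ffunE.
transitivity ((\prod_v (node_weight (label v) ^+ size (legs (D := D) (inl v)) *
   node_stat (label v) (site_stat (@ends L _ I O D) (@port L _ I O D) s (inl v)))) *
   ([forall w, all (fun h => s h.1 == bit w) (legs (D := D) (inr w))]%:R : scalar L)).
  case: ifP => _; rewrite ?mulr0 // mulr1; apply: eq_bigr => v _.
  by rewrite entry_stat size_map site_stat_legs.
congr (_ * _); first by apply: eq_bigr => v _; rewrite mulrC.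
rewrite -prod_natr_forall; apply: eq_bigr => z _; congr ((_ : bool)%:R).
rewrite site_stat_legs zeros_eq0 ones_eq0 /unzip2 -map_comp.
by case: (bit z); rewrite all_map; apply: eq_all => h /=; case: (s h.1).
Qed.
End Amplitude.

(** * Networks containing [n] copies of one box *)

Section BoxedNet.
Variables (F : fieldType) (Xo Xi Eo Ei : finType).
Variables (endso : Eo -> bool -> Xo) (porto : Eo -> bool -> 'I_4).
Variables (endsi : Ei -> bool -> Xo + Xi) (porti : Ei -> bool -> 'I_4).
Variables (fo : Xo -> stat -> F) (wo : Xo -> F).
Variables (B : finType) (fi : B -> Xi -> stat -> F) (wi : Xi -> F).

(** An edge in [Ei] is copied along with the box; an end of it lying outside is shared by all its
    copies. *)
Definition boxed_ends n (e : Eo + Ei * 'I_n) (t : bool) : Xo + Xi * 'I_n :=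
  match e with
  | inl e => inl (endso e t)
  | inr (e, c) => match endsi e t with inl x => inl x | inr x => inr (x, c) end
  end.

Definition boxed_port n (e : Eo + Ei * 'I_n) (t : bool) : 'I_4 :=
  match e with inl e => porto e t | inr (e, _) => porti e t end.

Definition boxed_fun n (beta : 'I_n -> B) (x : Xo + Xi * 'I_n) : stat -> F :=
  match x with inl x => fo x | inr (x, c) => fi (beta c) x end.

Definition boxed_weight n (x : Xo + Xi * 'I_n) : F :=
  match x with inl x => wo x | inr (x, _) => wi x end.

Definition attached : pred Xo :=
  fun x => [exists e, [exists t, endsi e t == inl x]].

Definition attached_site : finType := {x : Xo | attached x}.

(** What the copies contribute to the outer sites. Restricting to attached sites makes the number of
    states depend on the surroundings of the box alone. *)
Definition state : finNmodType := {ffun attached_site -> stat}.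

(** A sum of at most one term, which extends [q] by 0 to the sites that are not attached. *)
Definition state_at (q : state) (x : Xo) : stat :=
  \sum_(z : attached_site | val z == x) q z.

Definition inner_sum (s : {ffun Ei -> bool}) : state :=
  [ffun z => site_stat endsi porti s (inl (val z))].

Definition inner_weight (b : B) (s : {ffun Ei -> bool}) : F :=
  (\prod_x fi b x (site_stat endsi porti s (inr x))) *
  \prod_(h : Ei * bool) match endsi h.1 h.2 with inl x => wo x | inr x => wi x end.

Definition outer_fun (q : state) : F :=
  (\sum_(s : {ffun Eo -> bool})
     \prod_x fo x (site_stat endso porto s x + state_at q x)) *
  \prod_(h : Eo * bool) wo (endso h.1 h.2).

Lemma state_at_inner n (s : 'I_n -> {ffun Ei -> bool}) x :
  state_at (\sum_c inner_sum (s c)) x =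
  \sum_c site_stat endsi porti (s c) (inl x).
Proof.
rewrite /state_at.
under eq_bigr do rewrite sum_ffunE.
rewrite exchange_big /=; apply: eq_bigr => c _.
have [ax|nax] := boolP (attached x).
  by rewrite (big_pred1 (exist _ x ax)) ?ffunE.
rewrite big_pred0; last by move=> z; apply: contraNF nax => /eqP<-; apply: valP.
rewrite /site_stat big_pred0 // => h; apply: contraNF nax => hx.
by apply/existsP; exists h.1; apply/existsP; exists h.2.
Qed.

(** A configuration of a copy is an assignment of bits to its edges. An inner site sees its own copy
    only, whereas the statistic of an outer site is, by additivity, its outer part plus the
    contributions of all copies. *)
Lemma boxed_net_sum n (beta : 'I_n -> B) :
  net_sum (@boxed_ends n) (@boxed_port n) (boxed_fun beta) (@boxed_weight n) =
  wordsum inner_sum inner_weight outer_fun beta 0.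
Proof.
(* Each half-edge belongs either to the outer part or to exactly one copy. *)
have half_big (T : Type) (idx : T) (op : Monoid.com_law idx)
    (P : pred ((Eo + Ei * 'I_n) * bool)) (G : (Eo + Ei * 'I_n) * bool -> T) :
  \big[op/idx]_(h | P h) G h =
  op (\big[op/idx]_(h | P (inl h.1, h.2)) G (inl h.1, h.2))
     (\big[op/idx]_c \big[op/idx]_(h | P (inr (h.1, c), h.2)) G (inr (h.1, c), h.2)).
  pose phi (h : Eo * bool + 'I_n * (Ei * bool)) : (Eo + Ei * 'I_n) * bool :=
    match h with inl h => (inl h.1, h.2) | inr (c, h) => (inr (h.1, c), h.2) end.
  have bphi : bijective phi.
    exists (fun h => match h with
      (inl e, t) => inl (e, t) | (inr (e, c), t) => inr (c, (e, t)) end);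
    by [move=> [[]|[? []]] | move=> [[?|[]]]].
  rewrite (reindex _ (onW_bij _ bphi)) /= big_sumType /=; congr (op _ _).
  by rewrite pair_big_dep /=; apply: eq_big => -[c h].
rewrite /net_sum half_big /wordsum /= /outer_fun.
pose phi (t : {ffun 'I_n -> {ffun Ei -> bool}} * {ffun Eo -> bool}) :
    {ffun Eo + Ei * 'I_n -> bool} :=
  [ffun e => match e with inl e => t.2 e | inr (e, c) => t.1 c e end].
have bphi : bijective phi.
  exists (fun s : {ffun Eo + Ei * 'I_n -> bool} =>
    ([ffun c => [ffun e => s (inr (e, c))]], [ffun e => s (inl e)])).
    move=> [si so]; congr (_, _); apply/ffunP => e; rewrite !ffunE //.
    by apply/ffunP => x; rewrite !ffunE.
  by move=> s; apply/ffunP => -[e|[e c]]; rewrite !ffunE.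
have Hi si so x c : site_stat (@boxed_ends n) (@boxed_port n) (phi (si, so))
    (inr (x, c)) = site_stat endsi porti (si c) (inr x).
  rewrite /site_stat half_big big_pred0 // [LHS]add0r.
  rewrite (bigD1 c) //= [X in _ + X]big1 ?addr0.
    apply: eq_big => [[e t]|[e t] _] /=; last by rewrite /half_stat ffunE.
    by case: (endsi e t) => [y|y]; apply/eqP/eqP => // -[->].
  move=> c' c'c; rewrite big_pred0 // => h /=; case: (endsi h.1 h.2) => // y.
  by apply/eqP => -[_ /eqP]; rewrite (negPf c'c).
have Ho si so x : site_stat (@boxed_ends n) (@boxed_port n) (phi (si, so))
    (inl x) = site_stat endso porto so x + state_at (0 + \sum_c inner_sum (si c)) x.
  rewrite add0r state_at_inner /site_stat half_big; congr (_ + _).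
    by apply: eq_big => [[e t]|[e t] _] //=; rewrite /half_stat ffunE.
  apply: eq_bigr => c _.
  apply: eq_big => [[e t]|[e t] _] /=; last by rewrite /half_stat ffunE.
    by case: (endsi e t) => [y|y]; apply/eqP/eqP => // -[->].
rewrite (reindex _ (onW_bij _ bphi)) /=.
rewrite -(pair_bigA _ (fun si so => \prod_x boxed_fun beta x
  (site_stat (@boxed_ends n) (@boxed_port n) (phi (si, so)) x))) /=.
rewrite mulr_suml; apply: eq_bigr => si _.
rewrite mulrA [RHS]mulrAC -mulrA [_ * \prod_c _]mulrC !mulrA; congr (_ * _).
rewrite !mulr_suml; apply: eq_bigr => so _.
rewrite big_sumType /= -mulrA; congr (_ * _).
  by apply: eq_bigr => x _; rewrite Ho.
rewrite /inner_weight big_split /=; congr (_ * _).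
  rewrite exchange_big /= pair_big /=; apply: eq_bigr => -[x c] _ /=.
  by rewrite Hi.
by apply: eq_bigr => c _; apply: eq_bigr => h _; case: (endsi h.1 h.2).
Qed.
End BoxedNet.

(** * Splitting the copies along one !-box *)

Section SplitCopies.
Variables (b : nat) (d : {ffun 'I_b -> nat}) (k : 'I_b).

Definition upd (n : nat) : {ffun 'I_b -> nat} :=
  [ffun j => if j == k then n else d j].

(* In a copy index of upd 1, the component at k is 0: such an index selects a
   copy of everything but the box k. *)
Definition base_index : finType := copy_index (upd 1).

(** The index types on the two sides have different bounds, which [inord] bridges; [val_put] gives
    conditions under which no value is lost. *)
Definition put n (c : base_index) (i : nat) : copy_index (upd n) :=
  [ffun j => inord (if j == k then i else c j)].

Definition strip n (c : copy_index (upd n)) : base_index :=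
  [ffun j => inord (if j == k then 0%N else c j)].

Lemma index_bound (e : {ffun 'I_b -> nat}) (a : bool) j m :
  (m < if a then e j else 1)%N -> (m < (\max_i e i).+1)%N.
Proof.
case: a => [mj|]; last by case: m.
by rewrite ltnS (leq_trans (ltnW mj)) // leq_bigmax.
Qed.

Lemma put_bound n (A : {set 'I_b}) c i j :
  index_ok A (c : base_index) -> (i < if k \in A then n else 1)%N ->
  ((if j == k then i else c j) < if j \in A then upd n j else 1)%N.
Proof.
move=> /forallP/(_ j) cj iA; move: cj; rewrite !ffunE.
by case: eqP => [->|].
Qed.

Lemma val_put n A c i j :
  index_ok A (c : base_index) -> (i < if k \in A then n else 1)%N ->
  put n c i j = (if j == k then i else c j) :> nat.
Proof.
by move=> cA iA; rewrite ffunE inordK //; apply: index_bound (put_bound _ cA iA).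
Qed.

Lemma put_ok n A c i :
  index_ok A (c : base_index) -> (i < if k \in A then n else 1)%N ->
  index_ok A (put n c i).
Proof.
move=> cA iA; apply/forallP => j; rewrite (val_put _ cA iA).
exact: put_bound.
Qed.

Lemma strip_bound n (A : {set 'I_b}) (c : copy_index (upd n)) j :
  index_ok A c ->
  ((if j == k then 0%N else c j) < if j \in A then upd 1 j else 1)%N.
Proof.
move=> /forallP/(_ j); rewrite !ffunE.
by case: eqP => // _ _; case: ifP.
Qed.

Lemma val_strip n A (c : copy_index (upd n)) j :
  index_ok A c -> strip c j = (if j == k then 0%N else c j) :> nat.
Proof.
by move=> cA; rewrite ffunE inordK //; apply: index_bound (strip_bound _ cA).
Qed.

Lemma strip_ok n A (c : copy_index (upd n)) : index_ok A c -> index_ok A (strip c).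
Proof.
move=> cA; apply/forallP => j; rewrite (val_strip _ cA); exact: strip_bound.
Qed.

Lemma base_index0 A (c : base_index) : index_ok A c -> c k = 0%N :> nat.
Proof.
move=> /forallP/(_ k); rewrite ffunE eqxx.
by case: ifP => _; rewrite ltnS leqn0 => /eqP.
Qed.

Lemma strip_cut_put n (A A' : {set 'I_b}) c i : A \subset A' ->
  index_ok A' (c : base_index) -> (i < if k \in A' then n else 1)%N ->
  strip (cut A (put n c i)) = cut A c.
Proof.
move=> sA cA iA; apply/ffunP => j; apply: ord_inj.
have kA := cut_ok sA (put_ok cA iA).
rewrite (val_strip _ kA) !ffunE; have := val_put j cA iA; rewrite ffunE.
case: eqP => [->|_]; first by case: ifP => //; rewrite (base_index0 cA).
by case: ifP.
Qed.

Lemma cut_id (e : {ffun 'I_b -> nat}) A (c : copy_index e) :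
  index_ok A c -> cut A c = c.
Proof.
move=> cA; apply/ffunP => j; apply: ord_inj; rewrite ffunE.
by have := forallP cA j; case: ifP => // _; case: (c j) => -[].
Qed.

Variables (T : finType) (S : T -> {set 'I_b}).

Definition outer_copies : finType :=
  {tc : T * base_index | (k \notin S tc.1) && index_ok (S tc.1) tc.2}.

Definition inner_copies : finType :=
  {tc : T * base_index | (k \in S tc.1) && index_ok (S tc.1) tc.2}.

Lemma outer_ok n (z : outer_copies) :
  index_ok (S (val z).1) (put n (val z).2 0).
Proof. by case/andP: (valP z) => /negPf kz ok; apply: put_ok; rewrite ?kz. Qed.

Lemma inner_ok n (z : inner_copies) (i : 'I_n) :
  index_ok (S (val z).1) (put n (val z).2 i).
Proof. by case/andP: (valP z) => kz ok; apply: put_ok; rewrite ?kz. Qed.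

Definition join_copies n (z : outer_copies + inner_copies * 'I_n) :
    copies (upd n) S :=
  match z with
  | inl z => exist _ ((val z).1, put n (val z).2 0) (outer_ok n z)
  | inr (z, i) => exist _ ((val z).1, put n (val z).2 i) (inner_ok z i)
  end.

Lemma split_outer n (w : copies (upd n) S) : k \notin S (val w).1 ->
  (k \notin S (val w).1) && index_ok (S (val w).1) (strip (val w).2).
Proof. by move=> ->; apply: strip_ok (valP w). Qed.

Lemma split_inner n (w : copies (upd n) S) : k \in S (val w).1 ->
  (k \in S (val w).1) && index_ok (S (val w).1) (strip (val w).2).
Proof. by move=> ->; apply: strip_ok (valP w). Qed.

Lemma split_lt n (w : copies (upd n) S) : k \in S (val w).1 ->
  ((val w).2 k < n)%N.
Proof. by move=> kw; have /forallP/(_ k) := valP w; rewrite kw ffunE eqxx. Qed.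

Definition split_copies n (w : copies (upd n) S) :
    outer_copies + inner_copies * 'I_n :=
  match boolP (k \in S (val w).1) with
  | AltTrue kw => inr (exist _ ((val w).1, strip (val w).2) (split_inner kw),
                       Ordinal (split_lt kw))
  | AltFalse kw => inl (exist _ ((val w).1, strip (val w).2) (split_outer kw))
  end.

Lemma strip_put n A c i :
  index_ok A (c : base_index) -> (i < if k \in A then n else 1)%N ->
  strip (put n c i) = c.
Proof.
move=> cA iA; rewrite -[LHS](cut_id (strip_ok (put_ok cA iA))).
rewrite -[RHS](cut_id cA) -(strip_cut_put (subxx A) cA iA).
by rewrite !cut_id ?strip_ok ?put_ok.
Qed.

Lemma put_strip n A (c : copy_index (upd n)) i :
  index_ok A c -> c k = i :> nat -> put n (strip c) i = c.
Proof.
move=> cA ci; apply/ffunP => j; apply: ord_inj.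
have iA : (i < if k \in A then n else 1)%N.
  by have /forallP/(_ k) := cA; rewrite ffunE eqxx ci.
rewrite (val_put _ (strip_ok cA) iA) (val_strip _ cA).
by case: eqP => [->|].
Qed.

(** A copy of something inside [k] amounts to its [strip] and its component at [k]. Outside [k] that
    component is 0, so the [strip] alone determines the copy. *)
Lemma join_copies_bij n : bijective (@join_copies n).
Proof.
exists (@split_copies n).
  move=> [z|[z i]]; rewrite /split_copies; case/andP: (valP z) => kz ok.
    case: {-}_ / boolP => kw; first by have := kw; rewrite /= (negPf kz).
    congr inl; apply: val_inj; rewrite /= (strip_put ok) ?(negPf kz) //.
    by rewrite -surjective_pairing.
  case: {-}_ / boolP => kw; last by have := kw; rewrite /= kz.
  congr (inr (_, _)); apply: val_inj; rewrite /=.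
    by rewrite (strip_put ok) ?kz // -surjective_pairing.
  by rewrite (val_put _ ok) ?eqxx ?kz.
move=> w; rewrite /split_copies; case: {-}_ / boolP => kw; apply: val_inj => /=.
  by rewrite (put_strip (valP w)) // -surjective_pairing.
rewrite (put_strip (valP w)) -?surjective_pairing //.
have /forallP/(_ k) := valP w.
by rewrite (negPf kw) ltnS leqn0 => /eqP.
Qed.
End SplitCopies.

(** Used with [A'] the boxes of an edge and [A] those of one end: the copy number at [k] is
    forgotten exactly when that end lies outside [k]. *)
Lemma cut_put b (d : {ffun 'I_b -> nat}) k n (A A' : {set 'I_b})
    (c : base_index d k) i :
  A \subset A' -> index_ok A' c -> (i < if k \in A' then n else 1)%N ->
  cut A (put n c i) = put n (cut A c) (if k \in A then i else 0).
Proof.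
move=> sA cA iA; have kA := cut_ok sA cA.
have iA' : ((if k \in A then i else 0) < if k \in A then n else 1)%N.
  by case: ifP => // /(subsetP sA) kA'; rewrite kA' in iA.
apply/ffunP => j; apply: ord_inj; rewrite (val_put _ kA iA') !ffunE.
have := val_put j cA iA; rewrite ffunE.
by case: eqP => [->|_]; case: ifP.
Qed.

Section BoxBits.
Variables (b : nat) (d : {ffun 'I_b -> nat}) (k : 'I_b).
Variables (I O : finType) (wbox : 'I_b -> {set I + O}).

Definition boundary_index : finType := ((I + O) * base_index d k)%type.
(** The alphabet of the automata. Indexing it also by pairs that name no copy makes it independent
    of [n] and common to both sides of an equation. *)
Definition bits : finType := {ffun boundary_index -> bool}.

Definition wire_boxes (w : I + O) : {set 'I_b} := [set j | w \in wbox j].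

(** The default [false] concerns copy numbers at least [n], which no actual copy has. *)
Definition copy_bit n (gamma : bits) (beta : 'I_n -> bits)
    (w : I + O) (c : copy_index (upd d k n)) : bool :=
  if k \in wire_boxes w then
    oapp (fun i => beta i (w, strip c)) false (insub (c k : nat))
  else gamma (w, strip c).

Definition boundary_bit n (gamma : bits) (beta : 'I_n -> bits)
    (w : copies (upd d k n) (in_boxes wbox) + copies (upd d k n) (out_boxes wbox)) :=
  match w with
  | inl z => copy_bit gamma beta (inl (val z).1) (val z).2
  | inr z => copy_bit gamma beta (inr (val z).1) (val z).2
  end.

Lemma copy_bit_outer n gamma (beta : 'I_n -> bits) w (a : base_index d k) :
  k \notin wire_boxes w -> index_ok (wire_boxes w) a ->
  copy_bit gamma beta w (cut (wire_boxes w) (put n a 0)) = gamma (w, a).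
Proof.
move=> kw aok; rewrite /copy_bit (negPf kw) (strip_cut_put (subxx _) aok).
  by rewrite cut_id.
by rewrite (negPf kw).
Qed.

Lemma copy_bit_inner n gamma (beta : 'I_n -> bits) w (a : base_index d k) (c : 'I_n) :
  k \in wire_boxes w -> index_ok (wire_boxes w) a ->
  copy_bit gamma beta w (cut (wire_boxes w) (put n a c)) = beta c (w, a).
Proof.
move=> kw aok; rewrite /copy_bit kw (strip_cut_put (subxx _) aok) ?kw //.
rewrite cut_id // (cut_put (subxx _) aok) kw // (cut_id aok).
by rewrite (val_put _ aok) ?kw // eqxx valK.
Qed.

Lemma copy_bit_onto n (w : I + O) (h : copy_index (upd d k n) -> bool)
    (gamma : bits) (beta : 'I_n -> bits) (c : copy_index (upd d k n)) :
  index_ok (wire_boxes w) c ->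
  (forall a, gamma (w, a) = h (put n a 0)) ->
  (forall i a, beta i (w, a) = h (put n a i)) ->
  copy_bit gamma beta w c = h c.
Proof.
move=> cok Hg Hb; rewrite /copy_bit.
have := forallP cok k; rewrite ffunE eqxx; case: ifP => kw kc.
  by rewrite insubT /= Hb (put_strip cok).
by rewrite Hg (put_strip cok) //; case: (c k : nat) kc.
Qed.

(** Every basis vector of the boundary splits into bits [gamma] for the wires outside [k] and one
    letter per copy of [k], so words account for all matrix entries. *)
Lemma boundary_bit_onto n
    (h : copies (upd d k n) (in_boxes wbox) + copies (upd d k n) (out_boxes wbox)
       -> bool) :
  exists (gamma : bits) (beta : 'I_n -> bits), boundary_bit gamma beta =1 h.
Proof.
pose g (w : I + O) (c : copy_index (upd d k n)) := match w with
  | inl i => oapp (fun z : copies (upd d k n) (in_boxes wbox) => h (inl z)) false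
                  (insub (i, c))
  | inr o => oapp (fun z : copies (upd d k n) (out_boxes wbox) => h (inr z)) false
                  (insub (o, c))
  end.
pose get (i : nat) : bits := [ffun wc => g wc.1 (put n wc.2 i)].
exists (get 0%N), (fun i => get i) => -[z|z] /=.
  rewrite (copy_bit_onto (h := g (inl (val z).1))) ?(valP z) //.
  - by rewrite /g -surjective_pairing valK.
  - by move=> a; rewrite ffunE.
  - by move=> i a; rewrite ffunE.
rewrite (copy_bit_onto (h := g (inr (val z).1))) ?(valP z) //.
- by rewrite /g -surjective_pairing valK.
- by move=> a; rewrite ffunE.
- by move=> i a; rewrite ffunE.
Qed.
End BoxBits.

Section SplitInstance.
Variables (L : calculus) (p b : nat) (I O : finType).
Variables (wbox : 'I_b -> {set I + O}) (D : family L p wbox).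
Variables (d : {ffun 'I_b -> nat}) (k : 'I_b) (x : {ffun 'I_p -> value L}).

Notation outer S := (outer_copies d k S).
Notation inner S := (inner_copies d k S).
Local Notation sboxes := (@boxes L p b I O wbox D).
Local Notation eboxes := (@edge_boxes L p b I O wbox D).

Definition outer_edge_weaken (e : outer eboxes) t :
  (k \notin sboxes (ends (val e).1 t)) &&
  index_ok (sboxes (ends (val e).1 t)) (cut (sboxes (ends (val e).1 t)) (val e).2).
Proof.
case/andP: (valP e) => ke ok; rewrite (cut_ok (ends_boxes _ _) ok) andbT.
by apply: contra ke; apply: (subsetP (ends_boxes _ _)).
Qed.

Lemma inner_edge_cut (e : inner eboxes) t :
  index_ok (sboxes (ends (val e).1 t)) (cut (sboxes (ends (val e).1 t)) (val e).2).
Proof. by case/andP: (valP e) => _; apply: cut_ok (ends_boxes _ _). Qed.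

Definition outer_ends (e : outer eboxes) (t : bool) : outer sboxes :=
  exist _ (ends (val e).1 t, cut (sboxes (ends (val e).1 t)) (val e).2)
    (outer_edge_weaken e t).

(** An edge counts as inside [k] as soon as one of its ends is, so the other end may be outside. *)
Definition inner_ends (e : inner eboxes) (t : bool) :
    outer sboxes + inner sboxes :=
  let y := ends (val e).1 t in
  match boolP (k \in sboxes y) with
  | AltTrue ky => inr (exist _ (y, cut (sboxes y) (val e).2)
                         (introT andP (conj ky (inner_edge_cut e t))))
  | AltFalse ky => inl (exist _ (y, cut (sboxes y) (val e).2)
                         (introT andP (conj ky (inner_edge_cut e t))))
  end.

Definition copy_fun (g : bits d k I O) (z : (vert D + (I + O)) * base_index d k) :
    stat -> scalar L :=
  match z.1 with
  | inl v => node_stat (node_map (phase_eval x) (label v))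
  | inr w => check_bit (scalar L) (g (w, z.2))
  end.

Definition copy_weight (z : (vert D + (I + O)) * base_index d k) : scalar L :=
  if z.1 is inl v then node_weight (node_map (phase_eval x) (label v)) else 1.

(** An instance keeps the copies of generators, inputs and outputs in three separate types; this
    passes to them from the copies of all sites taken together. *)
Definition site_copy n (z : copies (upd d k n) sboxes) :
    copies (upd d k n) (vert_boxes (D := D)) +
    (copies (upd d k n) (in_boxes wbox) + copies (upd d k n) (out_boxes wbox)) :=
  copy_end (valP z) (subxx _).

Lemma copy_endE n (y : vert D + (I + O)) (A : {set 'I_b})
    (c : copy_index (upd d k n)) (cA : index_ok A c) (yA : sboxes y \subset A)
    (yc : index_ok (sboxes y) (cut (sboxes y) c)) :
  copy_end cA yA = site_copy (exist _ (y, cut (sboxes y) c) yc).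
Proof.
rewrite /site_copy; case: y yA yc => [v|[i|o]] yA yc;
  [congr inl | congr (inr (inl _)) | congr (inr (inr _))];
  by apply: val_inj; rewrite /= [in RHS]cut_id //=; apply: cut_ok cA.
Qed.

Lemma site_copy_bij n : bijective (@site_copy n).
Proof.
pose okc tc := index_ok (sboxes tc.1) (tc.2 : copy_index (upd d k n)).
pose back (w : copies (upd d k n) (vert_boxes (D := D)) +
    (copies (upd d k n) (in_boxes wbox) + copies (upd d k n) (out_boxes wbox))) :
    copies (upd d k n) sboxes :=
  match w with
  | inl z => exist okc (inl (val z).1, (val z).2) (valP z)
  | inr (inl z) => exist okc (inr (inl (val z).1), (val z).2) (valP z)
  | inr (inr z) => exist okc (inr (inr (val z).1), (val z).2) (valP z)
  end.
exists back => [[[[v|[i|o]] c] ok]|[[[v c] ok]|[[[i c] ok]|[[o c] ok]]]];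
 rewrite /site_copy /=;
 [..| congr inl | congr (inr (inl _)) | congr (inr (inr _))];
 by apply: val_inj; rewrite /= cut_id.
Qed.

(** The number [n] enters on the right only as the length of the word [beta]: alphabet, states,
    weights and final values are the same for all [n]. *)
Lemma amplitude_instance n (gamma : bits d k I O) (beta : 'I_n -> bits d k I O) :
  amplitude (instance D (upd d k n) x)
    [ffun i => boundary_bit gamma beta (inl i)]
    [ffun o => boundary_bit gamma beta (inr o)] =
  2 ^+ loops D *
  wordsum (inner_sum inner_ends (fun e t => port (val e).1 t))
    (inner_weight inner_ends (fun e t => port (val e).1 t)
       (fun z => copy_weight (val z)) (fun g z => copy_fun g (val z))
       (fun z => copy_weight (val z)))
    (outer_fun outer_ends (fun e t => port (val e).1 t)
       (fun z => copy_fun gamma (val z)) (fun z => copy_weight (val z)))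
    beta 0.
Proof.
rewrite amplitude_net; congr (_ * _).
rewrite -boxed_net_sum.
apply: (net_sum_iso (phi := @site_copy n \o @join_copies b d k _ _ n)
   (psi := @join_copies b d k _ _ n)).
- by apply: bij_comp; [apply: site_copy_bij | apply: join_copies_bij].
- exact: join_copies_bij.
- have yc (e : copies (upd d k n) eboxes) t := cut_ok (ends_boxes (val e).1 t) (valP e).
  move=> e t; rewrite /= (copy_endE _ _ (yc _ t)); congr (site_copy _).
  apply: val_inj; case: e => [e|[e c]] /=; case/andP: (valP e) => ke ok.
    rewrite (cut_put (ends_boxes _ t) ok) ?(negPf ke) //.
    by case: ifP.
  rewrite (cut_put (ends_boxes _ t) ok) ?ke // /inner_ends.
  by case: {-}_ / boolP => ky /=; rewrite ?ky ?(negPf ky).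
- by move=> [e|[e c]].
- move=> [z|[z c]] m; rewrite /= /copy_fun /=; case/andP: (valP z);
    case: z => -[[v|[i|o]] a] kok //= ka aok.
- by rewrite (copy_bit_outer gamma beta (w := inl i) ka aok).
- by rewrite (copy_bit_outer gamma beta (w := inr o) ka aok).
- by rewrite (copy_bit_inner gamma beta (w := inl i) c ka aok).
- by rewrite (copy_bit_inner gamma beta (w := inr o) c ka aok).
- by move=> [[[[v|[i|o]] a] ?]|[[[[v|[i|o]] a] ?] c]].
Qed.
End SplitInstance.

(** * Bounding the numbers of copies *)

Lemma wordsum_scale (F : fieldType) (B : finType) (Q : finNmodType) (S : finType)
    (mu : S -> Q) (P : B -> S -> F) (G : Q -> F) n (beta : 'I_n -> B) q a :
  a * wordsum mu P G beta q = wordsum mu P (fun q => a * G q) beta q.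
Proof.
by rewrite /wordsum mulr_sumr; apply: eq_bigr => s _; rewrite mulrA.
Qed.

Section AttachedBound.
Variables (L : calculus) (p b : nat) (I O : finType).
Variables (wbox : 'I_b -> {set I + O}) (D : family L p wbox).
Variables (d : {ffun 'I_b -> nat}) (k : 'I_b).
Hypothesis sepD : separated_family D.

(** An edge joins [z], outside [k], to a site in [k]. If [z] is in [j], this edge rules out the last
    case of separation, and [j] inside [k] would put [z] in [k]; what remains is [k] inside [j]. *)
Lemma attached_inside (z : outer_copies d k (boxes (D := D))) j :
  attached (inner_ends (D := D) (d := d) (k := k)) z ->
  j \in boxes (D := D) (val z).1 -> inside D k j.
Proof.
case/existsP => e /existsP[t /eqP]; rewrite /inner_ends.
case: {-}_ / boolP => // ky [<-] /= jy.
have jk : j != k by apply: contraNneq ky => jk; rewrite jk in jy.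
have kn : k \in boxes (D := D) (ends (val e).1 (~~ t)).
  by case/andP: (valP e) => + _; rewrite !inE; case: (t) ky => /negPf-> //=; rewrite orbF.
case/or3P: (sepD jk) => // [jik|/existsPn/(_ (val e).1)/existsPn/(_ t)].
  have /andP[/subsetP sv /subsetP sw] := inside_sub jik.
  move: ky jy; case: (ends _ _) => [v|w] /=; rewrite !inE.
    by move=> /negP kv /sv.
  by move=> /negP kv /sw.
by rewrite jy kn.
Qed.

(** An attached site is determined by its original and its copy index, whose components vanish
    except at boxes around [k], where they are bounded through [N]. *)
Lemma card_attached N : (forall j, inside D k j -> (d j <= N)%N) ->
  (#|attached_site (inner_ends (D := D) (d := d) (k := k))| <=
   (#|vert D| + (#|I| + #|O|)) * N.+1 ^ b)%N.
Proof.
move=> dN.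
pose phi (z : attached_site (inner_ends (D := D) (d := d) (k := k))) :
  (vert D + (I + O)) * {ffun 'I_b -> 'I_N.+1} :=
  ((val (val z)).1, [ffun j => inord ((val (val z)).2 j)]).
have small (z : attached_site (inner_ends (D := D) (d := d) (k := k))) j :
      ((val (val z)).2 j <= N)%N.
  have /andP[kz /forallP/(_ j)] :
      (k \notin boxes (D := D) (val (val z)).1) &&
      index_ok (boxes (D := D) (val (val z)).1) (val (val z)).2.
    exact: valP (val z).
  case: ifP => [jz|_]; last by rewrite ltnS leqn0 => /eqP->.
  have ij := attached_inside (valP z) jz; rewrite ffunE.
  case: eqP => [jk|_]; first by rewrite ltnS leqn0 => /eqP->.
  by move=> /ltnW/leq_trans; apply; apply: dN.
have inj : injective phi.
  move=> z1 z2 [e1 e2]; apply/val_inj/val_inj.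
  rewrite [LHS]surjective_pairing [RHS]surjective_pairing e1; congr (_, _).
  apply/ffunP => j; apply: ord_inj.
  have := congr1 (fun g : {ffun 'I_b -> 'I_N.+1} => (g j : nat)) e2.
  by rewrite !ffunE !inordK ?ltnS; [apply | apply: small | apply: small].
have := leq_card phi inj.
by rewrite card_prod !card_sum card_ffun !card_ord.
Qed.
End AttachedBound.

Section BoxInduction.
Variables (L : calculus) (p b : nat) (I O : finType).
Variables (wbox : 'I_b -> {set I + O}) (D1 D2 : family L p wbox).
Variable x : {ffun 'I_p -> value L}.
Hypotheses (sep1 : separated_family D1) (sep2 : separated_family D2).
Hypothesis nest : inside D1 =2 inside D2.

Definition agree (d : {ffun 'I_b -> nat}) : Prop :=
  amplitude (instance D1 d x) =2 amplitude (instance D2 d x).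

Definition site_count : nat :=
  (#|vert D1| + #|vert D2| + (#|I| + #|O|))%N.

(** A bound for the states of two automata together: [c * N.+1 ^ e] bounds the attached sites and
    [4 ^ 6] is the number of values of [stat]. *)
Definition box_bound (c e N : nat) : nat := (2 * (4 ^ 6) ^ (c * N.+1 ^ e))%N.

Lemma card_state_bound (D : family L p wbox) (d : {ffun 'I_b -> nat}) k N :
  separated_family D -> (#|vert D| + (#|I| + #|O|) <= site_count)%N ->
  (forall j, inside D k j -> (d j <= N)%N) ->
  (#|state (inner_ends (D := D) (d := d) (k := k))| <=
   (4 ^ 6) ^ (site_count * N.+1 ^ b))%N.
Proof.
move=> sepD cD dN; rewrite card_ffun card_stat leq_exp2l.
  by apply: leq_trans (card_attached sepD dN) _; rewrite leq_mul2r cD orbT.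
by rewrite -[1%N](exp1n 6) ltn_exp2r.
Qed.

(** Both sides share their boundary, so their automata read the same words, and it suffices to
    compare words no longer than the total number of states. *)
Lemma agree_upd (d : {ffun 'I_b -> nat}) k N :
  (forall j, inside D1 k j -> (d j <= N)%N) ->
  (forall n, (n <= box_bound site_count b N)%N -> agree (upd d k n)) ->
  forall n, agree (upd d k n).
Proof.
move=> dN H n xi yo.
have [gamma [beta Hbit]] := boundary_bit_onto (wbox := wbox) (d := d) (k := k) (n := n)
  (fun w => match w with inl i => xi i | inr o => yo o end).
have -> : xi = [ffun i => boundary_bit gamma beta (inl i)].
  by apply/ffunP => i; rewrite ffunE Hbit.
have -> : yo = [ffun o => boundary_bit gamma beta (inr o)].
  by apply/ffunP => i; rewrite ffunE Hbit.
(* The powers of 2 coming from loops may differ between the two sides; they are absorbed into the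
   final values. *)
rewrite !amplitude_instance !wordsum_scale.
apply: wordsum_agree => m beta' nQ; rewrite -!wordsum_scale -!amplitude_instance.
apply: H; apply: leq_trans nQ _; rewrite /box_bound mul2n -addnn leq_add //.
  apply: card_state_bound => //; rewrite /site_count; lia.
apply: card_state_bound => // [|j]; last by rewrite -nest; apply: dN.
rewrite /site_count; lia.
Qed.

Definition depth (k : 'I_b) : nat := #|[set j | inside D1 k j]|.

Lemma depth_lt k j : inside D1 k j -> (depth j < depth k)%N.
Proof.
move=> kj; apply: proper_card; apply/properP; split.
  by apply/subsetP => i; rewrite !inE; apply: inside_trans kj.
by exists j; rewrite !inE // inside_irr.
Qed.

(** The value [N r] bounds the copies of boxes of depth below [r]. Bounds are lifted box by box: for
    a box [k] whose surrounding boxes are bounded, [agree_upd] reduces any number of copies to at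
    most [N (depth k).+1]. *)
Lemma agree_all (N : nat -> nat) :
  {homo N : m n / (m <= n)%N} ->
  (forall r, (box_bound site_count b (N r) <= N r.+1)%N) ->
  (forall d : {ffun 'I_b -> nat},
     (forall j, (d j <= N (depth j).+1)%N) -> agree d) ->
  forall d, agree d.
Proof.
move=> mono grow H.
(* [S] is the set of boxes whose numbers of copies are still bounded; it is closed under passing to
   surrounding boxes. The claim is the case of the empty set, and [H] that of all boxes. *)
suff K m (S : {set 'I_b}) : #|~: S| = m ->
    (forall k j, k \in S -> inside D1 k j -> j \in S) ->
    forall d : {ffun 'I_b -> nat},
      (forall j, j \in S -> (d j <= N (depth j).+1)%N) -> agree d.
  by move=> d; apply: (K _ set0 erefl) => [k j|j]; rewrite inE.
elim: m S => [|m IH] S cS closed d dS.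
  apply: H => j; apply: dS; apply: contraT => jS.
  by have /cards0_eq/setP/(_ j) := cS; rewrite !inE jS.
have [k0 k0S] : exists k0, k0 \in ~: S by apply/card_gt0P; rewrite cS.
case: (@arg_minnP _ k0 [pred k | k \notin S] depth) => [|k /= kS kmin].
  by rewrite /= -in_setC.
(* k having minimal depth outside S, all boxes around k are in S. *)
have up j : inside D1 k j -> j \in S.
  move=> kj; apply: contraT => jS; have := kmin j jS.
  by rewrite leqNgt depth_lt.
have <- : upd d k (d k) = d.
  by apply/ffunP => j; rewrite ffunE; case: eqP => // ->.
apply: (agree_upd (N := N (depth k))) => [j kj|n nN].
  by apply: leq_trans (dS _ (up _ kj)) (mono _ _ (depth_lt kj)).
apply: (IH (k |: S)).
- by rewrite setCU setIC -setDE; have := cardsD1 k (~: S); rewrite cS inE kS => -[].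
- move=> i j; rewrite !inE => /predU1P[->|iS] ij; first by rewrite up // orbT.
  by rewrite (closed i) ?orbT.
move=> j; rewrite !inE ffunE; case: eqP => [-> _|_ jS].
  exact: leq_trans nN (grow _).
exact: dS.
Qed.
End BoxInduction.

(** * Phase variables *)

Section Expi.
Variable R : realType.

Lemma expiD (a c : R) : expi (a + c) = expi a * expi c.
Proof.
by rewrite /expi cosD sinD; congr (_ +i* _)%C; rewrite addrC [X in X + _]mulrC.
Qed.

Lemma expi0 : expi 0 = 1 :> R[i].
Proof. by rewrite /expi cos0 sin0. Qed.

Lemma expi_unit (a : R) : expi a != 0.
Proof.
apply: contraNneq (oner_neq0 R[i]) => a0.
by rewrite -expi0 -(subrr a) expiD a0 mul0r.
Qed.

Lemma expiN (a : R) : expi (- a) = (expi a)^-1.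
Proof.
by apply: (mulfI (expi_unit a)); rewrite -expiD subrr expi0 divff ?expi_unit.
Qed.

Lemma expi_mulrz (a : R) (m : int) : expi (a *~ m) = expi a ^ m.
Proof.
have nat_case n : expi (a *+ n) = expi a ^+ n.
  by elim: n => [|n IH]; rewrite ?expi0 // mulrS exprS expiD IH.
by case: m => n; rewrite ?NegzE ?mulrNz ?expiN -pmulrn nat_case // -exprnN.
Qed.

(** Half the difference of two such angles, taken in order, lies in [0, pi). Its sine vanishes
    because the full difference has cosine 1, so it is 0. *)
Lemma expi_inj : {in (fun a : R => (0 <= a) && (a < 2 * pi)) &, injective (@expi R)}.
Proof.
suff H (a c : R) : 0 <= c <= a -> a < 2 * pi -> expi a = expi c -> a = c.
  move=> a c /andP[a0 a2] /andP[c0 c2] ac; have [ca|/ltW ca] := leP c a.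
    by apply: H; rewrite ?c0.
  by apply/esym/H; rewrite ?a0.
move=> /andP[c0 ca] a2 [ec es].
pose u := (a - c) / 2; have uu : a - c = u + u by rewrite /u; lra.
have := cosB a c; rewrite ec es -!expr2 cos2Dsin2 uu cosD -!expr2 => cu.
have su : sin u = 0.
  by apply/eqP; rewrite -sqrf_eq0; apply/eqP; have := cos2Dsin2 u; lra.
have [u0|u0] := eqVneq u 0; first by lra.
have : 0 < sin u.
  by apply: sin_gt0_pi; apply/andP; split; [rewrite lt_def u0 /= /u|rewrite /u]; lra.
by rewrite su ltxx.
Qed.
End Expi.

(** * Laurent polynomials of bounded degree in one variable *)

Section LaurentBounded.
Variables (V : eqType) (F : fieldType) (point : V -> F) (neg : bool).

(* Negative exponents occur only if neg holds, and are then cleared by the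
   m-th power of the point. *)
Definition laurent_bounded (m : nat) (f : V -> F) : Prop :=
  exists2 P : {poly F}, (size P <= m.*2.+1)%N &
    forall v, neg ==> (point v != 0) -> P.[point v] = point v ^+ (neg * m) * f v.

Lemma lb_ext m f g : f =1 g -> laurent_bounded m f -> laurent_bounded m g.
Proof. by move=> fg [P sP HP]; exists P => // v /HP; rewrite fg. Qed.

Lemma lb_leq m m' f : (m <= m')%N -> laurent_bounded m f -> laurent_bounded m' f.
Proof.
move=> mm' [P sP HP]; exists (P * 'X^(neg * (m' - m))).
  apply: leq_trans (size_polyMleq _ _) _; rewrite size_polyXn.
  by case: neg {HP}; lia.
move=> v /HP Pv; rewrite hornerM hornerXn Pv mulrAC -exprD -mulnDr.
by rewrite subnKC.
Qed.

Lemma lb_const c : laurent_bounded 0 (fun=> c).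
Proof.
exists c%:P; first exact: size_polyC_leq1.
by move=> v _; rewrite hornerC muln0 mul1r.
Qed.

Lemma lb_add m f g : laurent_bounded m f -> laurent_bounded m g ->
  laurent_bounded m (fun v => f v + g v).
Proof.
move=> [P sP HP] [Q sQ HQ]; exists (P + Q).
  by apply: leq_trans (size_polyD _ _) _; rewrite geq_max sP.
by move=> v vn; rewrite hornerD HP // HQ // mulrDr.
Qed.

Lemma lb_mul m1 m2 f g : laurent_bounded m1 f -> laurent_bounded m2 g ->
  laurent_bounded (m1 + m2) (fun v => f v * g v).
Proof.
move=> [P sP HP] [Q sQ HQ]; exists (P * Q).
  by apply: leq_trans (size_polyMleq _ _) _; lia.
by move=> v vn; rewrite hornerM HP // HQ // mulrACA -exprD mulnDr.
Qed.

Lemma lb_sum m (T : eqType) (r : seq T) (P : pred T) (f : T -> V -> F) :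
  {in r, forall i, laurent_bounded m (f i)} ->
  laurent_bounded m (fun v => \sum_(i <- r | P i) f i v).
Proof.
elim: r => [|i r IH] H.
  by apply: lb_ext (lb_leq (leq0n m) (lb_const 0)) => v; rewrite big_nil.
have {}IH := IH (sub_in1 (fun k => @mem_behead _ (i :: r) k) H).
case Pi: (P i).
  by apply: lb_ext (lb_add (H i (mem_head _ _)) IH) => v; rewrite big_cons Pi.
by apply: lb_ext IH => v; rewrite big_cons Pi.
Qed.

Lemma lb_prod (T : Type) (r : seq T) (m : T -> nat) (f : T -> V -> F) :
  (forall i, laurent_bounded (m i) (f i)) ->
  laurent_bounded (\sum_(i <- r) m i) (fun v => \prod_(i <- r) f i v).
Proof.
move=> H; elim: r => [|i r IH].
  by rewrite big_nil; apply: lb_ext (lb_const 1) => v; rewrite big_nil.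
by rewrite big_cons; apply: lb_ext (lb_mul (H i) IH) => v; rewrite big_cons.
Qed.

Lemma lb_expz m (e : int) : (absz e <= m)%N -> ((e < 0) ==> neg) ->
  laurent_bounded m (fun v => point v ^ e).
Proof.
move=> em; case: e em => n /= nm en.
  (* If [neg] holds, the clearing power multiplies non-negative powers too, whence exponents up to
     twice the bound. *)
  apply: lb_leq nm _; exists 'X^(n + neg * n).
    by rewrite size_polyXn; case: neg en; lia.
  by move=> v _; rewrite hornerXn exprD mulrC.
have {en} nE : neg by [].
apply: lb_leq nm _; exists 1; first by rewrite size_poly1.
move=> v; rewrite nE /= => v0; rewrite hornerC mul1n NegzE -exprnN.
by rewrite mulfV // expf_neq0.
Qed.

(** The cleared polynomial has degree at most [m.*2] and more roots than that, so it is zero. *)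
Lemma lb_vanish m f (s : seq V) : laurent_bounded m f ->
  uniq (map point s) -> (m.*2 < size s)%N ->
  all (fun v => (neg ==> (point v != 0)) && (f v == 0)) s ->
  forall v, neg ==> (point v != 0) -> f v = 0.
Proof.
move=> [P sP HP] us ms /allP sf v vn.
have P0 : P = 0.
  apply/eqP; apply: contraTT (ms) => Pn0; rewrite -leqNgt.
  have rP : all (root P) (map point s).
    rewrite all_map; apply/allP => u us' /=; have /andP[un /eqP fu] := sf u us'.
    by rewrite rootE HP // fu mulr0.
  rewrite -ltnS (leq_trans _ sP) // -(size_map point); exact: max_poly_roots.
have := HP v vn; rewrite P0 horner0 => /esym/eqP; rewrite mulf_eq0.
(* The clearing factor is a non-trivial power only if [neg] holds, and then the point is
   non-zero. *)
case/orP => [|/eqP //]; rewrite expf_eq0 => /andP[+ v0].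
by case: neg vn; rewrite ?v0 ?mul0n.
Qed.
End LaurentBounded.

Definition phase_point (L : calculus) : value L -> scalar L :=
  match L return value L -> scalar L with
  | ZX R => @expi R
  | ZW F => id
  | ZH F _ => id
  end.

(* A phase of ZX has an inverse for every variable, e^(i x) being nonzero. *)
Definition invertible (L : calculus) (neg : bool) : bool :=
  if L is ZX _ then true else neg.

Definition set_var (V : Type) p (x : {ffun 'I_p -> V}) (j : 'I_p) (v : V) :
    {ffun 'I_p -> V} :=
  [ffun i => if i == j then v else x i].

Lemma set_varE (V : Type) p (x : {ffun 'I_p -> V}) j v i :
  set_var x j v i = if i == j then v else x i.
Proof. by rewrite ffunE. Qed.

(** In ZX the exponential turns an integer-linear phase into a constant times one power of e^(i v);
    in ZW and ZH each term of the phase gives one monomial in [v]. *)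
Lemma phase_laurent (L : calculus) p (f : phase L p) (x : {ffun 'I_p -> value L})
    j neg : phase_neg f j ==> neg ->
  laurent_bounded (@phase_point L) (invertible L neg) (phase_size f)
    (fun v => phase_point (phase_eval (set_var x j v) f)).
Proof.
have laur (F : fieldType) (g : laurent F p) (y : {ffun 'I_p -> F}) :
    laurent_neg g j ==> neg ->
    laurent_bounded (id : F -> F) neg (laurent_size g)
      (fun v => laurent_eval (set_var y j v) g).
  move=> gn; apply: (lb_ext (f := fun v => \sum_(t <- g)
     (t.1 * \prod_(i < p | i != j) y i ^ t.2 i) * v ^ t.2 j)).
    move=> v; apply: eq_bigr => t _.
    rewrite [in RHS](bigD1 j) //= set_varE eqxx -mulrA [X in _ * X]mulrC.
    congr (_ * (_ * _)); apply: eq_bigr => i /negPf ij.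
    by rewrite set_varE ij.
  apply: lb_sum => t tg; rewrite -[laurent_size g]add0n.
  apply: lb_mul; first exact: lb_const.
  apply: (lb_expz (id : F -> F)).
    rewrite /laurent_size (perm_big _ (perm_to_rem tg)) big_cons /= (bigD1 j) //=.
    lia.
  apply/implyP => tj; apply: (implyP gn); apply/hasP; exists t => //.
case: L f x => [R|F|F F2] f x /= fn; [|exact: laur|exact: laur].
pose a := f.2 + \sum_(i < p | i != j) x i *~ f.1 i.
apply: (lb_ext (f := fun v => expi a * expi v ^ f.1 j)).
  move=> v; rewrite -expi_mulrz -expiD /zx_eval (bigD1 j) //= set_varE eqxx.
  rewrite /a -addrA [X in _ + X]addrC; congr (expi (_ + (_ + _))).
  by apply: eq_bigr => i /negPf ij; rewrite set_varE ij.
rewrite -add1n; apply: lb_mul; first exact: lb_leq (lb_const _ _ _).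
by apply: lb_expz; rewrite ?implybT // (bigD1 j) //= leq_addr.
Qed.

(** Since entries are affine in the point of their phase, the degree of a product of entries is at
    most the sum of the degrees of the phases. *)
Lemma entry_affine (L : calculus) P (u : node L P) (legs : seq ('I_4 * bool)) :
  match node_phase u with
  | Some f => exists a c, forall g : P -> value L,
      entry (node_map g u) legs = a + c * phase_point (g f)
  | None => exists a, forall g : P -> value L, entry (node_map g u) legs = a
  end.
Proof.
case: L u => [R|F|F F2].
- case=> [f|f|] /=; last by eexists.
    by exists (all negb (unzip2 legs))%:R, (all id (unzip2 legs))%:R => g; rewrite mulrC.
  exists (\prod_(e <- unzip2 legs) isqrt2 R).
  exists (\prod_(e <- unzip2 legs) (isqrt2 R * (-1) ^+ e)) => g.
  by rewrite [X in _ + X]mulrC.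
- case=> [f||] /=; [|by eexists|by eexists].
  by exists (all negb (unzip2 legs))%:R, (all id (unzip2 legs))%:R => g; rewrite mulrC.
case=> [|f] /=; first by eexists.
case: (all id _); first by exists 0, 1 => g; rewrite add0r mul1r.
by exists 1, 0 => g; rewrite mul0r addr0.
Qed.

Lemma entry_laurent (L : calculus) p (u : node L (phase L p)) legs
    (x : {ffun 'I_p -> value L}) j neg :
  (if node_phase u is Some f then phase_neg f j else false) ==> neg ->
  laurent_bounded (@phase_point L) (invertible L neg)
    (oapp (@phase_size L p) 0%N (node_phase u))
    (fun v => entry (node_map (phase_eval (set_var x j v)) u) legs).
Proof.
have := entry_affine u legs; case: (node_phase u) => [f [a [c E]] fn|[a E] _] /=.
  apply: (lb_ext (f := fun v => a + c * phase_point (phase_eval (set_var x j v) f))).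
    by move=> v; rewrite E.
  apply: lb_add; first by apply: lb_leq (lb_const _ _ _).
  rewrite -[phase_size f]add0n; apply: lb_mul; first exact: lb_const.
  exact: phase_laurent.
by apply: (lb_ext (f := fun=> a)) (lb_const _ _ _) => v; rewrite E.
Qed.

Lemma leq_expl m n e : (m <= n)%N -> (m ^ e <= n ^ e)%N.
Proof. by case: e => // e; rewrite leq_exp2r. Qed.

Section InstanceVariables.
Variables (L : calculus) (p b : nat) (I O : finType).
Variables (wbox : 'I_b -> {set I + O}) (D : family L p wbox).
Variables (d : {ffun 'I_b -> nat}) (j : 'I_p) (neg : bool) (N : nat).
Hypothesis dN : forall i, (d i <= N)%N.
Hypothesis Dneg : var_neg D j ==> neg.

Lemma card_copies_of (T : finType) (S : T -> {set 'I_b}) t :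
  (#|[set z : copies d S | (val z).1 == t]| <= N.+1 ^ b)%N.
Proof.
have inj : {in [set z : copies d S | (val z).1 == t] &,
    injective (fun z : copies d S => (val z).2)}.
  move=> z1 z2; rewrite !inE => /eqP e1 /eqP e2 e.
  by apply: val_inj; rewrite [LHS]surjective_pairing [RHS]surjective_pairing e1 e2 e.
rewrite -(card_in_imset inj); apply: leq_trans (max_card _) _.
rewrite card_ffun !card_ord; apply: leq_expl.
by rewrite ltnS; apply/bigmax_leqP => i _; apply: dN.
Qed.

Lemma sum_copies (T : finType) (S : T -> {set 'I_b}) (g : T -> nat) :
  (\sum_(z : copies d S) g (val z).1 <= N.+1 ^ b * \sum_t g t)%N.
Proof.
rewrite (partition_big (fun z : copies d S => (val z).1) predT) //= big_distrr /=.
apply: leq_sum => t _.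
rewrite (eq_bigr (fun=> g t)) => [|z /eqP-> //].
rewrite sum_nat_const leq_mul2r -cardsE card_copies_of orbT //.
Qed.

(** Each generator has at most [N.+1 ^ b] copies, and the degree of an entry is at most the size of
    its phase. *)
Lemma amplitude_laurent (x : {ffun 'I_p -> value L}) xi yo :
  laurent_bounded (@phase_point L) (invertible L neg) (N.+1 ^ b * family_size D)
    (fun v => amplitude (instance D d (set_var x j v)) xi yo).
Proof.
pose D0 := instance D d x.
pose term (s : {ffun edge D0 -> bool}) v : scalar L :=
  \prod_(w : copies d (vert_boxes (D := D)))
    entry (node_map (phase_eval (set_var x j v)) (label (val w).1))
      [seq (port (d := D0) h.1 h.2, s h.1) | h <- legs (D := D0) (inl w)].
(* The underlying graph does not depend on the values of the variables, so the legs of [D0] serve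
   for every [v]. *)
apply: (lb_ext (f := fun v => 2 ^+ loops D *
    \sum_(s | compatible (D := D0) xi yo s) term s v)); first by [].
rewrite -[(_ * _)%N]add0n; apply: lb_mul; first exact: lb_const.
apply: lb_sum => s _.
pose size_at (t : vert D) := oapp (@phase_size L p) 0%N (node_phase (label t)).
apply: (lb_leq (m := (\sum_(w : copies d (vert_boxes (D := D))) size_at (val w).1)%N)).
  apply: leq_trans (sum_copies (vert_boxes (D := D)) size_at) _.
  by rewrite leq_mul2l /family_size leq_addl orbT.
apply: lb_prod => w; apply: entry_laurent; apply/implyP => wn.
by apply: (implyP Dneg); apply/existsP; exists (val w).1.
Qed.
End InstanceVariables.

Lemma phase_point_inj (L : calculus) : {in @in_range L &, injective (@phase_point L)}.
Proof. by case: L => [R|F|F F2] //=; apply: expi_inj. Qed.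

Lemma invertible_point (L : calculus) neg (v : value L) :
  neg ==> (v != 0) -> invertible L neg ==> (phase_point v != 0).
Proof. by case: L v => [R|F|F F2] v //= _; apply: expi_unit. Qed.

(** The coordinates lying outside [s] are dealt with one at a time: with the others fixed, [U] is a
    Laurent polynomial that vanishes at enough sample values. *)
Lemma sample_vanish (L : calculus) p (U : {ffun 'I_p -> value L} -> scalar L)
    (neg : 'I_p -> bool) m n (s : seq (value L)) :
  sample n s -> (m.*2.+1 < n)%N ->
  (forall j x, laurent_bounded (@phase_point L) (invertible L (neg j)) m
     (fun v => U (set_var x j v))) ->
  let adm (x : {ffun 'I_p -> value L}) :=
    [forall j, in_range (x j) && (neg j ==> (x j != 0))] in
  (forall x : {ffun 'I_p -> value L}, adm x -> (forall j, x j \in s) -> U x = 0) ->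
  forall x, adm x -> U x = 0.
Proof.
move=> [us /allP rs ns] mn HU adm H.
suff K c (x : {ffun 'I_p -> value L}) : #|[set j | x j \notin s]| = c ->
    adm x -> U x = 0 by move=> x; apply: K erefl.
elim: c x => [|c IH] x cx ax.
  apply: H => // j; apply: contraT => xj.
  by have /cards0_eq/setP/(_ j) := cx; rewrite !inE xj.
have [j] : exists j, j \in [set j | x j \notin s] by apply/card_gt0P; rewrite cx.
rewrite inE => xj; have /andP[rj nj] := forallP ax j.
case: ns => [ns|full]; last by rewrite full in xj.
have {1}-> : x = set_var x j (x j).
  by apply/ffunP => i; rewrite set_varE; case: eqP => [->|].
pose q : pred (value L) := fun v => neg j ==> (v != 0).
pose s' := filter q s.
apply: (lb_vanish (s := s') (HU j x)).
- rewrite map_inj_in_uniq ?filter_uniq // => u v.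
  rewrite !mem_filter => /andP[_ su] /andP[_ sv]; apply: phase_point_inj; exact: rs.
(* The value 0 alone may have to be discarded, which leaves at least [m.*2.+1] sample values. *)
- have : (count (predC q) s <= 1)%N.
    rewrite (leq_trans (sub_count (a2 := pred1 0) _ s)) //.
      by move=> v /=; rewrite /q negb_imply negbK => /andP[].
    by rewrite count_uniq_mem //; case: (_ \in _).
  have := count_predC q s; rewrite ns size_filter. set a := count (predC q) s.
  by set e := count q s; lia.
- apply/allP => v; rewrite mem_filter => /andP[nv sv].
  rewrite invertible_point //=; apply/eqP; apply: IH; last first.
    apply/forallP => i; rewrite set_varE; case: eqP => [->|_]; last exact: (forallP ax).
    by rewrite rs.
  have := cardsD1 j [set j | x j \notin s]; rewrite cx inE xj => -[->].
  apply: eq_card => i; rewrite !inE set_varE; by case: eqP => //= _; rewrite sv.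
exact: (invertible_point nj).
Qed.

(** * Computable bounds and samples *)

Section Recursive.
Local Open Scope nat_scope.

Lemma rec_succ k (f : k.-tuple nat -> nat) :
  recursive f -> recursive (fun v => (f v).+1).
Proof.
move=> rf; apply: (Rec_ext _ (Rec_comp (g := fun _ : 'I_1 => f) Rec_succ (fun=> rf))).
by move=> v; rewrite /thead tnth_mktuple.
Qed.

Lemma rec_const k (c : nat) : recursive (fun _ : k.-tuple nat => c).
Proof. by elim: c => [|c IH]; [apply: Rec_zero | apply: rec_succ]. Qed.

(** Composition with [Rec_prim] lets the number of rounds be a function of the arguments, which
    remain available to the step. *)
Lemma rec_iter k (f : k.-tuple nat -> nat) (step : k.+2.-tuple nat -> nat) n :
  recursive f -> recursive step -> recursive n ->
  recursive (fun v : k.-tuple nat =>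
    iteri (n v) (fun i r => step [tuple of i :: r :: v]) (f v)).
Proof.
move=> rf rs rn.
pose g (i : 'I_k.+1) (v : k.-tuple nat) : nat :=
  if unlift ord0 i is Some j then tnth v j else n v.
have rg i : recursive (g i).
  rewrite /g; case: (unlift ord0 i) => [j|//]; exact: Rec_proj.
apply: (Rec_ext _ (Rec_comp (Rec_prim rf rs) rg)) => v.
have -> : [tuple g i v | i < k.+1] = [tuple of n v :: v].
  apply: eq_from_tnth => i; rewrite tnth_mktuple /g.
  case: unliftP => [j ->|->]; first by rewrite tnthS.
  by rewrite tnth0.
rewrite theadE; have -> // : behead_tuple [tuple of n v :: v] = v.
exact: val_inj.
Qed.

Lemma rec_nth k (j : nat) : j < k -> recursive (fun v : k.-tuple nat => nth 0 v j).
Proof.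
move=> jk; apply: (Rec_ext _ (Rec_proj (Ordinal jk))) => v.
by rewrite (tnth_nth 0).
Qed.

Lemma rec_add k (f g : k.-tuple nat -> nat) :
  recursive f -> recursive g -> recursive (fun v => f v + g v).
Proof.
move=> rf rg; apply: (Rec_ext _ (rec_iter rg (rec_succ (@rec_nth k.+2 1 isT)) rf)).
by move=> v /=; elim: (f v) => //= n ->.
Qed.

Lemma rec_weaken2 k (f : k.-tuple nat -> nat) : recursive f ->
  recursive (fun v : k.+2.-tuple nat => f (behead_tuple (behead_tuple v))).
Proof.
move=> rf; pose g (i : 'I_k) (v : k.+2.-tuple nat) := nth 0 v i.+2.
have rg i : recursive (g i) by apply: rec_nth; rewrite !ltnS.
apply: (Rec_ext _ (Rec_comp rf rg)) => v; congr f.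
apply: eq_from_tnth => i; rewrite tnth_mktuple (tnth_nth 0) /= !nth_behead //.
Qed.

Lemma rec_mul k (f g : k.-tuple nat -> nat) :
  recursive f -> recursive g -> recursive (fun v => f v * g v).
Proof.
move=> rf rg.
have rs := rec_add (rec_weaken2 rg) (@rec_nth k.+2 1 isT).
apply: (Rec_ext _ (rec_iter (rec_const k 0) rs rf)).
move=> v /=; elim: (f v) => //= n ->; rewrite mulSn; congr (g _ + _).
exact: val_inj.
Qed.

Lemma rec_exp k (f g : k.-tuple nat -> nat) :
  recursive f -> recursive g -> recursive (fun v => f v ^ g v).
Proof.
move=> rf rg.
have rs := rec_mul (rec_weaken2 rf) (@rec_nth k.+2 1 isT).
apply: (Rec_ext _ (rec_iter (rec_const k 1) rs rg)).
move=> v /=; elim: (g v) => //= n ->; rewrite expnS; congr (f _ * _).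
exact: val_inj.
Qed.

(** When [n] is the size of an equation it bounds the sites, the boxes and the depth of nesting;
    each round of [box_bound] treats one level. *)
Definition copy_bound (n : nat) : nat := iter n (box_bound n n) 0.
Definition degree_bound (n : nat) : nat := (copy_bound n).+1 ^ n * n.
(** A single number has to bound the copies and give the sample size, hence the sum. The second
    summand exceeds [m.*2.+1] for [m] the degree bound, as [sample_vanish] asks. *)
Definition instance_bound (n : nat) : nat := copy_bound n + (degree_bound n).*2.+2.

Lemma copy_bound_computable : computable copy_bound.
Proof.
have rn : recursive (fun v : 1.-tuple nat => nth 0 v 0) by apply: rec_nth.
(* Positions 0, 1 and 2 hold the counter, the previous value and the argument. *)
have rs : recursive (fun v : 3.-tuple nat =>
    box_bound (nth 0 v 2) (nth 0 v 2) (nth 0 v 1)).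
  apply: rec_mul; first exact: rec_const.
  apply: rec_exp; first exact: rec_const.
  apply: rec_mul; first exact: rec_nth.
  apply: rec_exp; last exact: rec_nth.
  by apply: rec_succ; apply: rec_nth.
apply: (Rec_ext _ (rec_iter (rec_const 1 0) rs rn)) => v /=.
rewrite /copy_bound /thead (tnth_nth 0) /=.
by elim: {1 4}(nth 0 v 0) => //= n ->.
Qed.

Lemma instance_bound_computable : computable instance_bound.
Proof.
have rc := copy_bound_computable.
have rn : recursive (fun v : 1.-tuple nat => thead v).
  by apply: (Rec_ext _ (Rec_proj ord0)).
apply: rec_add => //; do 2 apply: rec_succ.
apply: (Rec_ext (f := fun v : 1.-tuple nat =>
  degree_bound (thead v) + degree_bound (thead v))).
  by move=> v; rewrite addnn.
by apply: rec_add; (apply: rec_mul => //; apply: rec_exp => //; apply: rec_succ).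
Qed.
End Recursive.

(** Values in range are added one by one; if none is left, the list already contains them all. *)
Lemma sample_exists (L : calculus) n : exists s : seq (value L), sample n s.
Proof.
elim: n => [|n [s [us rs ns]]]; first by exists [::]; split => //; left.
have [full|/boolp.existsNP[a]] :=
    boolp.pselect (forall a : value L, in_range a -> a \in s).
  by exists s; split=> //; right.
move=> /boolp.not_implyP[ra /negP as'].
case: ns => [ns|full]; last by rewrite full in as'.
by exists (a :: s); split; rewrite /= ?as' ?ra //; left; rewrite ns.
Qed.

(** * The construction *)

Lemma interp_amplitude (L : calculus) (I O : finType)
    (D1 D2 : diagram L (value L) I O) :
  interp D1 = interp D2 <-> amplitude D1 =2 amplitude D2.
Proof.
split=> [/matrixP E x y|E]; last by apply/matrixP => r c; rewrite !mxE E.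
by have := E (enum_rank y) (enum_rank x); rewrite !mxE !enum_rankK.
Qed.

(** Stated with [List.In] because the values, later simple equations, have no decidable equality. *)
Lemma In_allpairs (A B : eqType) (C : Type) (f : A -> B -> C) s t a b :
  a \in s -> b \in t -> List.In (f a b) [seq f x y | x <- s, y <- t].
Proof.
move=> + bt; elim: s => // a' s IH; rewrite inE => as'.
apply/List.in_app_iff; have [e|na] := eqVneq a a'; [left|right].
  rewrite -e {as' IH}; elim: t bt => // b' t IH; rewrite inE => /predU1P[->|].
    by left.
  by right; apply: IH.
by apply: IH; rewrite (negPf na) in as'.
Qed.

Lemma In_instances (L : calculus) (E : equation L) n (s : seq (value L))
    (d : {ffun 'I_(nbox E) -> nat}) (x : {ffun 'I_(nvar E) -> value L}) :
  (forall j, (d j <= n)%N) -> (forall j, x j \in s) -> admissible x ->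
  List.In (at_params d x) (@instances L E n s).
Proof.
move=> dn xs ax; apply: In_allpairs.
  apply/mapP; exists [ffun j => inord (d j)]; first by rewrite mem_enum.
  by apply/ffunP => j; rewrite !ffunE /= inordK // ltnS.
rewrite mem_filter ax; apply/mapP.
have xi j : (index (x j) s < size s)%N by rewrite index_mem.
exists [ffun j => Ordinal (xi j)]; first by rewrite mem_enum.
by apply/ffunP => j; rewrite !ffunE (tnth_nth 0) nth_index.
Qed.

Lemma box_bound_mono c c' e e' m m' :
  (c <= c')%N -> (e <= e')%N -> (m <= m')%N ->
  (box_bound c e m <= box_bound c' e' m')%N.
Proof.
move=> cc ee mm; rewrite leq_mul2l /= leq_pexp2l ?expn_gt0 // leq_mul //.
by apply: leq_trans (leq_expl _ _) (leq_pexp2l _ ee).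
Qed.

Lemma equation_verified (L : calculus) (E : equation L) (s : seq (value L)) :
  sample (instance_bound (equation_size E)) s -> separated E -> well_nested E ->
  verifies E (instances E (instance_bound (equation_size E)) s).
Proof.
set n := equation_size E => smp [sepl sepr] nest HK d x ax.
rewrite /sound_simple interp_amplitude.
have szl : (family_size (lhs E) <= n)%N by rewrite /n /equation_size; lia.
have szr : (family_size (rhs E) <= n)%N by rewrite /n /equation_size; lia.
have bn : (nbox E <= n)%N by rewrite /n /equation_size; lia.
have cn : (site_count (lhs E) (rhs E) <= n)%N.
  rewrite /n /equation_size /site_count /family_size !card_ord; lia.
pose Nr r := iter r (box_bound n n) 0%N.
have homoN : {homo Nr : r r' / (r <= r')%N}.
  apply: homo_leq => //; first exact: leq_trans.
  by elim=> //= r IH; apply: box_bound_mono.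
(* The copies are bounded first, at the given [x]; the variables are treated afterwards, when the
   degrees are bounded. *)
apply: (agree_all sepl sepr nest homoN) => [r|{}d dN].
  exact: box_bound_mono.
(* No box is inside itself, so every depth is less than the number of boxes. *)
have dD j : (d j <= copy_bound n)%N.
  apply: leq_trans (dN j) (homoN _ _ _); apply: leq_trans bn.
  rewrite -[X in (_ <= X)%N]card_ord.
  apply: leq_trans _ (max_card (mem [set: 'I_(nbox E)])).
  apply: proper_card; apply/properP; split; first exact: subsetT.
  by exists j; rewrite ?inE // inside_irr.
move=> xi yo; apply/eqP; rewrite -subr_eq0; apply/eqP.
(* With the numbers of copies and the matrix entry fixed, the difference of the two sides is a
   function of the phase variables alone. *)
pose U y := amplitude (instance (lhs E) d y) xi yo -
  amplitude (instance (rhs E) d y) xi yo.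
pose neg j := var_neg (lhs E) j || var_neg (rhs E) j.
rewrite -/(U x).
apply: (sample_vanish (neg := neg) (m := degree_bound n) smp) ax => //.
- rewrite /instance_bound; lia.
- have deg (D : family L (nvar E) (wbox (e := E))) : (family_size D <= n)%N ->
     ((copy_bound n).+1 ^ nbox E * family_size D <= degree_bound n)%N.
    by move=> Dn; rewrite leq_mul // leq_pexp2l.
  move=> j y; apply: lb_add.
    by apply: lb_leq (deg _ szl) _; apply: amplitude_laurent;
      rewrite // /neg; apply/implyP=> ->.
  apply: (lb_ext (f := fun v =>
    -1 * amplitude (instance (rhs E) d (set_var y j v)) xi yo)).
    by move=> v; rewrite mulN1r.
  rewrite -[degree_bound n]add0n; apply: lb_mul; first exact: lb_const.
  apply: lb_leq (deg _ szr) _; apply: amplitude_laurent => //.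
  by rewrite /neg; apply/implyP=> ->; rewrite orbT.
move=> y ay ys; apply/eqP; rewrite subr_eq0; apply/eqP.
apply: (interp_amplitude _ _).1; apply: (HK (at_params d y)).
apply: In_instances => // j; apply: leq_trans (dD j) _.
by rewrite /instance_bound leq_addr.
Qed.

Theorem theorem8p58 (L : calculus) :
  exists K : equation L -> seq (simple_equation L),
    construction K /\
    forall E : equation L, separated E -> well_nested E -> verifies E (K E).
Proof.
(* The samples are chosen before any equation is given, so they depend on the bound only. *)
have [s Hs] := boolp.choice (@sample_exists L).
exists (fun E => instances E (instance_bound (equation_size E))
                           (s (instance_bound (equation_size E)))); split.
  by exists instance_bound, s; split=> //; apply: instance_bound_computable.
by move=> E; apply: equation_verified.
Qed.
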